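(* Let $n\ge 1$ and let $A_1,\ldots,A_n\subseteq\mathbb{R}^n$ be finite nonempty sets, where $A_i$ has cardinality $t_i$ and convex hull $P_i$ for $i=1,\ldots,n$. Then $$\mathbb{E}(A_1,\ldots,A_n)\ \le\ (2\pi)^{-\frac n2}\, V_0\,(t_1-1)\cdots(t_n-1),$$ where $V_0$ denotes the number of vertices of the Minkowski sum $P_1+\cdots+P_n$.
   Context: For a finite nonempty set $A\subseteq\mathbb{R}^n$ and a function $c\colon A\to\mathbb{R}$, define $F_{A,c}\colon\mathbb{R}^n\to\mathbb{R}$ by $F_{A,c}(w)=\sum_{a\in A}c(a)e^{\langle a,w\rangle}$. (Via $x=e^w$ taken componentwise, zeros $w\in\mathbb{R}^n$ correspond to zeros $x\in\mathbb{R}^n_{>0}$ of the generalized polynomial $\sum_{a\in A}c(a)x^a$.) For finite nonempty $A_1,\ldots,A_n\subseteq\mathbb{R}^n$, let all the coefficients $c_i(a)$, $i\in\{1,\ldots,n\}$, $a\in A_i$, be independent standard Gaussian random variables. Then $\mathbb{E}(A_1,\ldots,A_n)$ denotes the expectation of the number of nondegenerate zeros $w\in\mathbb{R}^n$ of the system $F_{A_1,c_1}(w)=0,\ldots,F_{A_n,c_n}(w)=0$. A zero is nondegenerate if the $n\times n$ Jacobian determinant of $(F_{A_1,c_1},\ldots,F_{A_n,c_n})$ does not vanish there. *)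

(* Defs.v *)
From HB Require Import structures.
From mathcomp Require Import all_boot all_order all_algebra.
From mathcomp Require Import finmap.
From mathcomp Require Import all_classical all_reals all_analysis.

Set Implicit Arguments.
Unset Strict Implicit.
Unset Printing Implicit Defensive.

Import Order.TTheory GRing.Theory Num.Theory.
Import numFieldNormedType.Exports.

Local Open Scope classical_set_scope.
Local Open Scope ring_scope.

Section Geometry.
Context {R : realType} {n : nat}.

Definition dotv (u v : 'rV[R]_n) : R := \sum_j u 0 j * v 0 j.

Definition convex_hull (S : set 'rV[R]_n) : set 'rV[R]_n :=
  smallest (@convex_set R 'rV[R]_n) S.

Definition minkowski_sum (I : finType) (P : I -> set 'rV[R]_n) :
    set 'rV[R]_n :=
  [set x | exists2 p : I -> 'rV[R]_n,
     (forall i, P i (p i)) & x = \sum_i p i].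

(* The nonempty faces of a polytope P are the sets of maximizers over P of the
   linear functionals. *)
Definition face (P : set 'rV[R]_n) (u : 'rV[R]_n) : set 'rV[R]_n :=
  [set x | P x /\ forall y, P y -> dotv u y <= dotv u x].

Definition vertices (P : set 'rV[R]_n) : set 'rV[R]_n :=
  [set v | exists u, face P u = [set v]].

End Geometry.

Section Systems.
Context {R : realType} {n : nat}.

Definition expsum (A : {fset 'rV[R]_n}) (c : A -> R) (w : 'rV[R]_n) : R :=
  \sum_(a : A) c a * expR (dotv (val a) w).

Definition expsystem (A : 'I_n -> {fset 'rV[R]_n}) (c : forall i, A i -> R)
    (w : 'rV[R]_n) : 'rV[R]_n :=
  \row_i expsum (@c i) w.

(* 'J acts on row vectors, hence is the transpose of the usual Jacobian matrix;
   the determinant is the same. *)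
Definition nondegenerate_zeros (A : 'I_n -> {fset 'rV[R]_n})
    (c : forall i, A i -> R) : set 'rV[R]_n :=
  [set w | expsystem c w = 0 /\ \det ('J (expsystem c) w) != 0].

End Systems.

Section Probability.
Context {d : measure_display} {Omega : measurableType d} {R : realType}.
Variable P : probability Omega R.

Definition standard_gaussian (X : {RV P >-> R}) : Prop :=
  forall B, measurable B -> distribution P X B = normal_prob 0 1 B.

Definition mutually_independent (I : finType) (X : I -> {RV P >-> R}) : Prop :=
  forall (J : {set I}) (B : I -> set R),
    (forall i, measurable (B i)) ->
    P (\bigcap_(i in [set` J]) X i @^-1` B i) =
    (\prod_(i in J) P (X i @^-1` B i))%E.

(* The number of zeros takes its values in \bar R, so its expectation is
   written as an integral rather than with the real-valued 'E_P. *)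
Definition expected_nondegenerate_zeros (n : nat)
    (A : 'I_n -> {fset 'rV[R]_n}) (c : forall i, A i -> {RV P >-> R}) :
    \bar R :=
  (\int[P]_om counting (nondegenerate_zeros (fun i a => c i a om)))%E.

End Probability.

(* Main.v *)
From HB Require Import structures.
Require Import Defs.
From mathcomp Require Import all_boot all_order all_algebra.
From mathcomp Require Import finmap.
From mathcomp Require Import all_classical all_reals all_analysis.
From mathcomp Require Import measurable_realfun.
From mathcomp Require Import ring lra.

(** A selection f picks one exponent f_i in every A_i; its cone C_f consists of
    the directions w for which every f_i maximizes <a, w> over A_i. Only the
    selections that are strict maximizers for some common direction are needed:
    their cones cover R^n ([strict_selections_cover]), and f |-> f_1 + ... + f_n
    maps them injectively to vertices of P_1 + ... + P_n
    ([card_strict_selections]). It is therefore enough to show that the zeros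
    in one cone contribute at most (2 pi)^(-n/2) (t_1 - 1) ... (t_n - 1).

    On C_f, divide the i-th equation by e^<f_i, w>. It becomes
    c_i(f_i) + G_i(w) = 0, where G_i involves the t_i - 1 other coefficients,
    which are independent of c_i(f_i), and the exponents a - f_i, which are
    nonpositive on C_f. The density of (c_1(f_1), ..., c_n(f_n)) is at most
    (2 pi)^(-n/2), so that, once G is fixed, the expected number of
    nondegenerate zeros in C_f is at most (2 pi)^(-n/2) times the integral of
    |det DG| over C_f. Expanding the determinant by multilinearity bounds that
    integral, in expectation, by the sum over all choices of g_i in
    A_i \ {f_i} of
      E|c_1(g_1)| ... E|c_n(g_n)| int_(C_f) |det (g_i - f_i)_i|
         e^(<g_1 - f_1, w> + ... + <g_n - f_n, w>) dw.
    Each E|c_i(g_i)| is at most 1. The substitution y_i = <f_i - g_i, w> sends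
    C_f into the positive orthant, where e^(- y_1 - ... - y_n) has integral 1
    ([cone_integral]); hence each of the (t_1 - 1) ... (t_n - 1) choices
    contributes at most 1.

    Instead of the area formula for G, the count of zeros goes through the
    integrals K_delta ([kac_count]), the sum over f of
      (2 delta)^(-n) int_(C_f) 1{|F_i(w)| <= delta for all i} |det D_f(w)| dw,
    where D_f ([jacmx]) has the exponents a - f_i in place of a in the Jacobian
    matrix of F, and so agrees with it at the zeros. Near a nondegenerate zero F
    is almost linear, and the set where every |F_i| <= delta almost contains a
    parallelepiped of volume (2 delta)^n / |det D|; so the number of
    nondegenerate zeros is at most liminf K_delta ([counting_le_liminf]).
    Fatou's lemma and Tonelli's theorem then reduce the theorem to the estimate
    above at a fixed w ([expectation_kac_density]), which follows by integrating
    out one coefficient at a time ([ge0_integral_eliminate]). Of Lebesgue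
    measure on R^n this uses Tonelli's theorem and the linear change of
    variables ([linear_change_unit]), which is proved by Gaussian elimination.
    The bound on the number of zeros passes to the expectation because the
    integral of a nonnegative function is a supremum over the simple functions
    below it, and so is monotone also for functions whose measurability is not
    known ([ge0_le_lower_integral]). *)
Import Order.TTheory GRing.Theory Num.Theory.
Import numFieldNormedType.Exports.
Set Implicit Arguments.
Unset Strict Implicit.
Unset Printing Implicit Defensive.
Local Open Scope classical_set_scope.
Local Open Scope ring_scope.

(** * Lebesgue measure on row vectors *)
Section measurable_rV.
Context {R : realType} {n : nat}.

Let coord : 'I_n -> 'rV[R]_n -> R := fun i x => x 0 i.

Let rV_set0 : g_sigma_preimage coord set0.
Proof. exact: sigma_algebra0. Qed.

Let rV_setC A : g_sigma_preimage coord A -> g_sigma_preimage coord (~` A).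
Proof. exact: sigma_algebraC. Qed.

Let rV_bigcup (F : _^nat) : (forall i, g_sigma_preimage coord (F i)) ->
  g_sigma_preimage coord (\bigcup_i (F i)).
Proof. exact: sigma_algebra_bigcup. Qed.

Definition rV_display : measure_display. Proof. exact. Qed.

HB.instance Definition _ := @isMeasurable.Build rV_display
  'rV[R]_n (g_sigma_preimage coord) rV_set0 rV_setC rV_bigcup.

Lemma measurable_coord i : measurable_fun setT (fun x : 'rV[R]_n => x 0 i).
Proof.
move=> _ Y mY; rewrite setTI; apply: sub_sigma_algebra => /=.
rewrite -bigcup_seq/=; exists i => /=; first by rewrite mem_index_enum.
by exists Y => //; rewrite setTI.
Qed.

Lemma measurable_fun_rVP d (T : measurableType d) (f : T -> 'rV[R]_n) :
  (forall i, measurable_fun setT (fun x => f x 0 i)) -> measurable_fun setT f.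
Proof.
move=> mf _ A mA; rewrite setTI.
have sub : g_sigma_preimage (fun i x => coord i (f x)) `<=` measurable.
  apply: smallest_sub; first exact: sigma_algebra_measurable.
  rewrite -bigcup_seq; apply: bigcup_sub => i _.
  by move=> _ [B mB <-]; exact: mf.
apply: sub; rewrite (g_sigma_preimage_comp coord f).
by exists A => //; rewrite setTI.
Qed.

End measurable_rV.

Section lebesgue_rV.
Context {R : realType}.
Local Notation leb := (@lebesgue_measure R).

(** A row of length n.+1 is an initial entry followed by a row of length n; this
    identification with R * R^n carries the recursive construction of Lebesgue
    measure. *)
Definition rV_cons n (xt : R * 'rV[R]_n) : 'rV[R]_n.+1 :=
  row_mx (xt.1%:M : 'rV_1) xt.2.

Lemma rV_consE0 n (xt : R * 'rV[R]_n) : rV_cons xt 0 ord0 = xt.1.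
Proof. by rewrite /rV_cons mxE; case: split_ordP => // j _; rewrite (ord1 j) mxE. Qed.

Lemma rV_consE n (xt : R * 'rV[R]_n) i : rV_cons xt 0 (lift ord0 i) = xt.2 0 i.
Proof.
rewrite /rV_cons mxE; case: split_ordP => j /(congr1 val)/= eij.
  by have := ltn_ord j; rewrite -eij.
by congr (xt.2 _ _); apply/val_inj; case: eij.
Qed.

Lemma measurable_rV_cons n : measurable_fun setT (@rV_cons n).
Proof.
apply: measurable_fun_rVP => i; case: (unliftP ord0 i) => [j ->|->].
  under eq_fun do rewrite rV_consE.
  apply: (measurableT_comp (measurable_coord j)); exact: measurable_snd.
under eq_fun do rewrite rV_consE0; exact: measurable_fst.
Qed.

Definition rV_uncons n (w : 'rV[R]_n.+1) : R * 'rV[R]_n :=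
  (w 0 ord0, \row_j w 0 (lift ord0 j)).

Lemma rV_consK n : cancel (@rV_cons n) (@rV_uncons n).
Proof.
move=> [x t]; rewrite /rV_uncons rV_consE0; congr (_, _).
by apply/rowP => j; rewrite mxE rV_consE.
Qed.

Lemma measurable_rV_uncons n : measurable_fun setT (@rV_uncons n).
Proof.
apply: measurable_fun_pair; first exact: measurable_coord.
by apply: measurable_fun_rVP => i; under eq_fun do rewrite mxE; exact: measurable_coord.
Qed.

Section step.
Context n (mu : {sigma_finite_measure set 'rV[R]_n -> \bar R}).

Definition lebesgue_rV_step : set 'rV[R]_n.+1 -> \bar R :=
  pushforward (leb \x mu)%E (@rV_cons n).

Let m A : measurable A -> measurable (@rV_cons n @^-1` A).
Proof. by move=> mA; rewrite -[X in measurable X]setTI; exact: measurable_rV_cons. Qed.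

Let lebesgue_rV_step0 : lebesgue_rV_step set0 = 0%E.
Proof. by rewrite /lebesgue_rV_step /pushforward preimage_set0 measure0. Qed.

Let lebesgue_rV_step_ge0 A : (0 <= lebesgue_rV_step A)%E.
Proof. by rewrite /lebesgue_rV_step /pushforward; exact: measure_ge0. Qed.

Let lebesgue_rV_step_sigma_additive : semi_sigma_additive lebesgue_rV_step.
Proof.
move=> F mF tF mUF; rewrite /lebesgue_rV_step /pushforward preimage_bigcup.
apply: measure_semi_sigma_additive.
- by move=> k; exact: m.
- apply/trivIsetP => /= i j _ _ ij; rewrite -preimage_setI.
  by move/trivIsetP : tF => /(_ _ _ _ _ ij) ->//; rewrite preimage_set0.
- by rewrite -preimage_bigcup; exact: m.
Qed.

HB.instance Definition _ := isMeasure.Build _ _ _ lebesgue_rV_step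
  lebesgue_rV_step0 lebesgue_rV_step_ge0 lebesgue_rV_step_sigma_additive.

Let lebesgue_rV_step_sigma_finite : sigma_finite setT lebesgue_rV_step.
Proof.
have /sigma_finiteP[F [TF ndF Foo]] := sigma_finiteT leb.
have /sigma_finiteP[G [TG ndG Goo]] := sigma_finiteT mu.
exists (fun k => @rV_uncons n @^-1` (F k `*` G k)).
  rewrite -preimage_bigcup (_ : \bigcup_k _ = setT) ?preimage_setT//.
  rewrite -setXTT TF TG predeqE => -[x y]; split.
    by move=> [k _ []/= ? ?]; split; exists k.
  move=> [/= [k _ Fkx] [l _ Gly]]; exists (maxn k l) => //; split.
  - by move: x Fkx; exact/subsetPset/ndF/leq_maxl.
  - by move: y Gly; exact/subsetPset/ndG/leq_maxr.
move=> k; have [? ?] := Foo k; have [? ?] := Goo k; split.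
  by rewrite -[X in measurable X]setTI; apply: measurable_rV_uncons => //; exact: measurableX.
rewrite /lebesgue_rV_step /pushforward -comp_preimage (_ : _ \o _ = id); last first.
  by apply/funext => x; rewrite /= rV_consK.
by rewrite preimage_id product_measure1E// lte_mul_pinfty// ge0_fin_numE.
Qed.

HB.instance Definition _ := Measure_isSigmaFinite.Build _ _ _ lebesgue_rV_step
  lebesgue_rV_step_sigma_finite.

End step.

Fixpoint lebesgue_rV n : {sigma_finite_measure set 'rV[R]_n -> \bar R} :=
  if n is n'.+1 then lebesgue_rV_step (lebesgue_rV n') else \d_(0 : 'rV[R]_0%N).

Local Open Scope ereal_scope.

Lemma ge0_integral_lebesgue_rV0 (f : 'rV[R]_0%N -> \bar R) : (forall w, 0 <= f w) ->
  \int[lebesgue_rV 0]_w f w = f 0%R.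
Proof.
move=> f0; have mf : measurable_fun setT f.
  have -> : f = cst (f 0%R) by apply/funext => w; rewrite /= (thinmx0 w).
  exact: measurable_cst.
by rewrite /lebesgue_rV integral_dirac// diracT mul1e.
Qed.

(** Tonelli's theorem, integrating over the first coordinate last; the variant
    below integrates over it first. *)
Lemma ge0_integral_lebesgue_rVS n (f : 'rV[R]_n.+1 -> \bar R) :
  measurable_fun setT f -> (forall w, 0 <= f w) ->
  \int[lebesgue_rV n.+1]_w f w = \int[leb]_x \int[lebesgue_rV n]_t f (rV_cons (x, t)).
Proof.
move=> mf f0; have mc := @measurable_rV_cons n.
rewrite [LHS](_ : _ = \int[pushforward (leb \x lebesgue_rV n) (@rV_cons n)]_w f w)//.
rewrite ge0_integral_pushforward// fubini_tonelli1//.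
- exact: measurableT_comp.
- by move=> x; exact: f0.
Qed.

Lemma ge0_integral_lebesgue_rVS_swap n (f : 'rV[R]_n.+1 -> \bar R) :
  measurable_fun setT f -> (forall w, 0 <= f w) ->
  \int[lebesgue_rV n.+1]_w f w = \int[lebesgue_rV n]_t \int[leb]_x f (rV_cons (x, t)).
Proof.
move=> mf f0; have mc := @measurable_rV_cons n.
rewrite [LHS](_ : _ = \int[pushforward (leb \x lebesgue_rV n) (@rV_cons n)]_w f w)//.
rewrite ge0_integral_pushforward// fubini_tonelli2//.
- exact: measurableT_comp.
- by move=> x; exact: f0.
Qed.

End lebesgue_rV.

(** * Linear changes of variables *)
Section change_of_variables.
Context {R : realType}.
Local Notation leb := (@lebesgue_measure R).
Local Open Scope ereal_scope.

(** Both sides are measures, and they agree on half-open intervals. For a < 0 the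
    preimage of such an interval is closed at the other end, which does not
    affect its length. *)
Lemma lebesgue_measure_affine (a b : R) (A : set R) : a != 0%R -> measurable A ->
  leb A = `|a|%:E * leb ((fun x : R => (a * x + b)%R) @^-1` A).
Proof.
move=> a0 mA; have r0 : (0 <= `|a|)%R by [].
pose phi : R -> measurableTypeR R := fun x => (a * x + b)%R.
have mphi : measurable_fun setT phi.
  by apply: measurable_funD => //; exact: measurable_funM.
rewrite [RHS](_ : _ = mscale (NngNum r0) (pushforward leb phi) A)//.
apply: lebesgue_measure_unique => //= _ [[x y] _ <-].
rewrite /mscale /pushforward/=.
have [ap|an] := ltP 0%R a.
  rewrite [X in _ * leb X](_ : _ = `](x - b) / a, (y - b) / a]%classic)%R; last first.
    apply/seteqP; split=> t /=; rewrite /phi !in_itv/=.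
      by rewrite ltr_pdivrMr// ler_pdivlMr// => /andP[? ?]; apply/andP; split; lra.
    by rewrite ltr_pdivrMr// ler_pdivlMr// => /andP[? ?]; apply/andP; split; lra.
  rewrite !lebesgue_measure_itv/= !lte_fin ltr_pM2r ?invr_gt0// ltrD2r.
  case: ifPn => _; last by rewrite mule0.
  rewrite -!EFinD -EFinM gtr0_norm//; congr (_%:E).
  by rewrite -mulrBl mulrC divfK//; lra.
have {}an : (a < 0)%R by rewrite lt_neqAle a0.
rewrite [X in _ * leb X](_ : _ = `[(y - b) / a, (x - b) / a[%classic)%R; last first.
  apply/seteqP; split=> t /=; rewrite /phi !in_itv/=.
    by rewrite ltr_ndivlMr// ler_ndivrMr// => /andP[? ?]; apply/andP; split; lra.
  by rewrite ltr_ndivlMr// ler_ndivrMr// => /andP[? ?]; apply/andP; split; lra.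
rewrite !lebesgue_measure_itv/= !lte_fin ltr_nM2r ?invr_lt0// ltrD2r.
case: ifPn => _; last by rewrite mule0.
rewrite -!EFinD -EFinM ltr0_norm//; congr (_%:E).
by rewrite -mulrBl mulrC mulrN divfK//; lra.
Qed.

Lemma ge0_integral_affine (a b : R) (f : R -> \bar R) : a != 0%R ->
  measurable_fun setT f -> (forall x, 0 <= f x) ->
  `|a|%:E * \int[leb]_x f (a * x + b)%R = \int[leb]_x f x.
Proof.
move=> a0 mf f0; have r0 : (0 <= `|a|)%R by [].
pose phi : R -> measurableTypeR R := fun x => (a * x + b)%R.
have mphi : measurable_fun setT phi.
  by apply: measurable_funD => //; exact: measurable_funM.
have -> : \int[leb]_x f (a * x + b)%R = \int[pushforward leb phi]_y f y.
  by rewrite ge0_integral_pushforward.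
rewrite -[LHS](ge0_integral_mscale (pushforward leb phi) measurableT (NngNum r0))//.
by apply: eq_measure_integral => A mA _; exact/esym/lebesgue_measure_affine.
Qed.

Lemma ge0_integral_translate (b : R) (f : R -> \bar R) :
  measurable_fun setT f -> (forall x, 0 <= f x) ->
  \int[leb]_x f (x + b)%R = \int[leb]_x f x.
Proof.
move=> mf f0; rewrite -[RHS](ge0_integral_affine b (oner_neq0 R))// normr1 mul1e.
by under [RHS]eq_integral do rewrite mul1r.
Qed.

Section slices.
Context n (f : 'rV[R]_n.+1 -> \bar R).
Hypothesis (mf : measurable_fun setT f) (f0 : forall w, 0 <= f w).

Lemma measurable_rV_cons1 x : measurable_fun setT (fun t => f (rV_cons (x, t))).
Proof.
apply: (measurableT_comp mf).
by apply: (measurableT_comp (@measurable_rV_cons R n)); exact: measurable_pair1.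
Qed.

Lemma measurable_rV_cons2 t : measurable_fun setT (fun x => f (rV_cons (x, t))).
Proof.
apply: (measurableT_comp mf).
by apply: (measurableT_comp (@measurable_rV_cons R n)); exact: measurable_pair2.
Qed.

Lemma measurable_lebesgue_rV_slice :
  measurable_fun setT (fun x => \int[lebesgue_rV n]_t f (rV_cons (x, t))).
Proof.
apply: (@measurable_fun_fubini_tonelli_F _ _ _ _ _ (lebesgue_rV n) (f \o @rV_cons R n)).
- exact: (measurableT_comp mf (@measurable_rV_cons R n)).
- by move=> x; exact: f0.
Qed.

Lemma lebesgue_rV_slice_ge0 x : 0 <= \int[lebesgue_rV n]_t f (rV_cons (x, t)).
Proof. by apply: integral_ge0. Qed.

End slices.

Lemma measurable_rV_add n (v : 'rV[R]_n) : measurable_fun setT (fun w : 'rV[R]_n => w + v)%R.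
Proof.
apply: measurable_fun_rVP => i; under eq_fun do rewrite mxE.
by apply: measurable_funD => //; exact: measurable_coord.
Qed.

Lemma measurable_mulmx n m (M : 'M[R]_(n, m)) :
  measurable_fun setT (fun w : 'rV[R]_n => w *m M).
Proof.
apply: measurable_fun_rVP => i; under eq_fun do rewrite mxE.
by apply: measurable_sum => j; apply: measurable_funM => //; exact: measurable_coord.
Qed.

Lemma ge0_integral_lebesgue_rV_translate n (v : 'rV[R]_n) (f : 'rV[R]_n -> \bar R) :
  measurable_fun setT f -> (forall w, 0 <= f w) ->
  \int[lebesgue_rV n]_w f (w + v)%R = \int[lebesgue_rV n]_w f w.
Proof.
elim: n v f => [|n IH] v f mf f0.
  by rewrite !ge0_integral_lebesgue_rV0// [v]thinmx0 addr0.
rewrite [RHS]ge0_integral_lebesgue_rVS// [LHS]ge0_integral_lebesgue_rVS//; last first.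
  by apply: (measurableT_comp mf); exact: measurable_rV_add.
have -> : (fun x => \int[lebesgue_rV n]_t f (rV_cons (x, t) + v)%R) =
          (fun x => \int[lebesgue_rV n]_t f (rV_cons (x + v 0 ord0, t)%R)).
  apply/funext => x.
  rewrite -(IH (rV_uncons v).2 (fun t => f (rV_cons (x + v 0 ord0, t)%R)))//.
    apply: eq_integral => t _; congr f; apply/rowP => i; rewrite mxE.
    case: (unliftP ord0 i) => [j ->|->]; rewrite ?(rV_consE,rV_consE0)//=.
    by rewrite !mxE.
  exact: measurable_rV_cons1.
have H := ge0_integral_translate (v 0%R ord0)
  (measurable_lebesgue_rV_slice mf f0) (lebesgue_rV_slice_ge0 f0).
etransitivity; last exact: H.
by apply: eq_integral => x _.
Qed.

Definition linear_change n (M : 'M[R]_n) := forall f : 'rV[R]_n -> \bar R,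
  measurable_fun setT f -> (forall w, 0 <= f w) ->
  `|\det M|%:E * \int[lebesgue_rV n]_w f (w *m M) = \int[lebesgue_rV n]_w f w.

Lemma linear_changeM n (M N : 'M[R]_n) :
  linear_change M -> linear_change N -> linear_change (M *m N).
Proof.
move=> hM hN f mf f0.
rewrite det_mulmx normrM EFinM -(hN f)// muleAC muleC; congr (_ * _).
rewrite -(hM (fun w => f (w *m N)))//; last first.
  by apply: (measurableT_comp mf); exact: measurable_mulmx.
by congr (_ * _); apply: eq_integral => w _; rewrite mulmxA.
Qed.


End change_of_variables.

Section linear_change.
Context {R : realType}.
Local Notation leb := (@lebesgue_measure R).
Local Open Scope ereal_scope.

(** The block of ones acts by (x, t) |-> (x, t + x u): for fixed x this is a
    translation of t. *)
Lemma linear_change_upper n (u : 'rV[R]_n) :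
  linear_change (block_mx 1%:M u 0 1%:M : 'M[R]_(1 + n))%R.
Proof.
move=> f mf f0; rewrite det_ublock !det1 mulr1 normr1 mul1e.
rewrite [LHS]ge0_integral_lebesgue_rVS ?ge0_integral_lebesgue_rVS//; last first.
  by apply: (measurableT_comp mf); exact: measurable_mulmx.
apply: eq_integral => x _.
rewrite -(ge0_integral_lebesgue_rV_translate (x *: u) (measurable_rV_cons1 mf x))//.
apply: eq_integral => t _; congr f; rewrite /rV_cons/= mul_row_block.
by rewrite mulmx0 addr0 !mulmx1 mul_scalar_mx addrC.
Qed.

(** Here (x, t) |-> (x + t l, t) translates x for fixed t, so x has to be
    integrated first. *)
Lemma linear_change_lower n (l : 'cV[R]_n) :
  linear_change (block_mx 1%:M 0 l 1%:M : 'M[R]_(1 + n))%R.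
Proof.
move=> f mf f0; rewrite det_lblock !det1 mulr1 normr1 mul1e.
rewrite [LHS]ge0_integral_lebesgue_rVS_swap ?ge0_integral_lebesgue_rVS_swap//; last first.
  by apply: (measurableT_comp mf); exact: measurable_mulmx.
apply: eq_integral => t _.
rewrite -(ge0_integral_translate ((t *m l) 0 0)%R (measurable_rV_cons2 mf t))//.
apply: eq_integral => x _; congr f; rewrite /rV_cons/= mul_row_block.
rewrite mulmx0 add0r !mulmx1; congr row_mx.
by apply/matrixP => i j; rewrite (ord1 i) (ord1 j) !mxE eqxx !mulr1n.
Qed.

Lemma linear_change_diag n (a : R) (S : 'M[R]_n) : a != 0%R ->
  linear_change S -> linear_change (block_mx a%:M 0 0 S : 'M[R]_(1 + n))%R.
Proof.
move=> a0 hS f mf f0; rewrite det_ublock det_scalar1 normrM EFinM.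
pose g := fun w : 'rV[R]_(1 + n) => f (w *m block_mx a%:M 0 0 S).
have mg : measurable_fun setT g.
  by apply: (measurableT_comp mf); exact: measurable_mulmx.
have g0 w : 0 <= g w by exact: f0.
rewrite [X in _ * X = _](_ : _ = \int[lebesgue_rV n.+1]_w g w)//.
rewrite ge0_integral_lebesgue_rVS// [RHS]ge0_integral_lebesgue_rVS//.
rewrite -[RHS](ge0_integral_affine 0 a0 (measurable_lebesgue_rV_slice mf f0))//; last first.
  by move=> x; exact: lebesgue_rV_slice_ge0.
rewrite -muleA; congr (_ * _).
rewrite -ge0_integralZl//; last 2 first.
- exact: measurable_lebesgue_rV_slice mg g0.
- by move=> x _; exact: integral_ge0.
apply: eq_integral => x _.
rewrite -[RHS](hS (fun t => f (rV_cons (a * x + 0, t)%R)))//; last first.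
  exact: measurable_rV_cons1.
congr (_ * _); apply: eq_integral => t _; rewrite /g; congr f.
rewrite /rV_cons/= mul_row_block !mulmx0 add0r !addr0; congr row_mx.
by apply/matrixP => i j; rewrite (ord1 i) (ord1 j) !mxE big_ord1 !mxE eqxx !mulr1n mulrC.
Qed.


Local Close Scope ereal_scope.

(** Induction on the size by block elimination. If the corner entry a is nonzero,
    the matrix is a product of a lower unipotent, a block diagonal and an upper
    unipotent matrix, and the Schur complement is handled by induction. If a = 0,
    some entry below it is nonzero, and adding that row to the first one makes the
    corner nonzero. *)
Lemma linear_change_unit n (M : 'M[R]_n) : M \in unitmx -> linear_change M.
Proof.
elim: n M => [|n IH] M uM.
  move=> f mf f0; rewrite det_mx00 normr1 mul1e !ge0_integral_lebesgue_rV0//.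
  by rewrite mul0mx.
have pivot (a : R) (u : 'rV[R]_n) (l : 'cV[R]_n) (S : 'M[R]_n) : a != 0%R ->
    (block_mx a%:M u l S : 'M[R]_(1 + n))%R \in unitmx ->
    linear_change (block_mx a%:M u l S : 'M[R]_(1 + n))%R.
  move=> a0.
  have -> : block_mx a%:M u l S = (block_mx 1%:M 0 (a^-1 *: l) 1%:M : 'M[R]_(1 + n))%R *m
      ((block_mx a%:M 0 0 (S - a^-1 *: (l *m u)) : 'M[R]_(1 + n))%R *m
       (block_mx 1%:M (a^-1 *: u) 0 1%:M : 'M[R]_(1 + n))%R).
    rewrite !mulmx_block !mulmx0 !mul0mx !mulmx1 !mul1mx !addr0 !add0r.
    rewrite mul_scalar_mx scalerA divff// scale1r.
    rewrite mul_mx_scalar scalerA divff// scale1r.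
    by rewrite -scalemxAl addrCA subrr addr0.
  rewrite !unitmx_mul => /and3P[_ uS _].
  apply: linear_changeM; first exact: linear_change_lower.
  apply: linear_changeM; last exact: linear_change_upper.
  apply: linear_change_diag => //; apply: IH.
  by move: uS; rewrite !unitmxE det_ublock unitrM => /andP[].
have [c [u [l [S eM]]]] : exists (c : R) (u : 'rV[R]_n) (l : 'cV[R]_n) (S : 'M[R]_n),
    M = block_mx c%:M u l S :> 'M[R]_(1 + n).
  exists (ulsubmx (M : 'M[R]_(1 + n)) ord0 ord0), (ursubmx (M : 'M[R]_(1 + n))).
  exists (dlsubmx (M : 'M[R]_(1 + n))), (drsubmx (M : 'M[R]_(1 + n))).
  by rewrite -mx11_scalar submxK.
rewrite {M}eM in uM *; have [c0|c0] := eqVneq c 0%R; last exact: pivot.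
have [j lj] : exists j, l j 0%R != 0%R.
  have [/existsP//|/existsPn l0] := boolP [exists j, l j 0%R != 0%R].
  have {}l0 : l = 0.
    by apply/colP => j; rewrite mxE; have := l0 j; rewrite negbK => /eqP.
  have := uM; rewrite unitmxE (_ : \det _ = 0) ?unitr0//.
  by rewrite l0 (@det_ublock R 1 n) c0 det_mx11 mxE mul0rn mul0r.
(* multiplying on the left by block_mx 1 e 0 1 adds row j of the lower blocks to the
   first row, and block_mx 1 (- e) 0 1 undoes it *)
pose e : 'rV[R]_n := delta_mx 0 j.
have eL : (block_mx 1%:M (- e) 0 1%:M : 'M[R]_(1 + n))%R *m
  ((block_mx 1%:M e 0 1%:M : 'M[R]_(1 + n))%R *m (block_mx c%:M u l S : 'M[R]_(1 + n))%R) =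
  block_mx c%:M u l S.
  rewrite mulmxA mulmx_block !mulmx0 !mul0mx !mulmx1 !mul1mx !addr0 !add0r.
  by rewrite subrr -scalar_mx_block mul1mx.
rewrite -eL; apply: linear_changeM; first exact: linear_change_upper.
have uE : (block_mx 1%:M e 0 1%:M : 'M[R]_(1 + n))%R \in unitmx.
  by rewrite unitmxE det_ublock !det1 mulr1 unitr1.
have : ((block_mx 1%:M e 0 1%:M : 'M[R]_(1 + n))%R *m
  (block_mx c%:M u l S : 'M[R]_(1 + n))%R) \in unitmx.
  by rewrite unitmx_mul uE.
rewrite mulmx_block !mul0mx !mul1mx !add0r c0 raddf0 add0r.
rewrite [e *m l]mx11_scalar; apply: pivot.
rewrite mxE (bigD1 j)//= mxE !eqxx mul1r big1 ?addr0// => k kj.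
by rewrite mxE (negbTE kj) andbF mul0r.
Qed.

End linear_change.

(** * Integrals over orthants and parallelepipeds *)
Section product_integrals.
Context {R : realType}.
Local Notation leb := (@lebesgue_measure R).

Lemma measurable_prod_coord n (h : 'I_n -> R -> R) :
  (forall i, measurable_fun setT (h i)) ->
  measurable_fun setT (fun w : 'rV[R]_n => \prod_i h i (w 0 i)).
Proof.
move=> mh; apply: measurable_prod => i _.
by apply: measurableT_comp => //; exact: measurable_coord.
Qed.

Lemma ge0_integral_lebesgue_rV_prod n (h : 'I_n -> R -> R) :
  (forall i, measurable_fun setT (h i)) -> (forall i x, 0 <= h i x) ->
  (\int[lebesgue_rV n]_w (\prod_i h i (w ord0 i))%:E = \prod_i \int[leb]_x (h i x)%:E)%E.
Proof.
elim: n h => [|n IH] h mh h0.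
  rewrite ge0_integral_lebesgue_rV0 ?big_ord0// => w.
  by rewrite lee_fin prodr_ge0.
have mp := measurable_prod_coord mh.
have mhE i : measurable_fun setT (fun x : R => (h i x)%:E) by exact/measurable_EFinP.
rewrite ge0_integral_lebesgue_rVS//; last 2 first.
- exact/measurable_EFinP.
- by move=> w; rewrite lee_fin prodr_ge0.
rewrite big_ord_recl -IH//.
rewrite -ge0_integralZr//; last 3 first.
- exact: (mhE ord0).
- by move=> x _; rewrite lee_fin.
- by apply: integral_ge0 => w _; rewrite lee_fin prodr_ge0.
apply: eq_integral => x _.
rewrite -ge0_integralZl//; last 3 first.
- by apply/measurable_EFinP; exact: (@measurable_prod_coord n (fun i => h (lift ord0 i))).
- by move=> w _; rewrite lee_fin prodr_ge0.
- by rewrite lee_fin.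
apply: eq_integral => t _; rewrite -EFinM; congr (_%:E).
rewrite big_ord_recl rV_consE0/=; congr (_ * _).
by apply: eq_bigr => i _; rewrite rV_consE.
Qed.

(** The integral over the cone where all coordinates of w M are nonnegative: the
    substitution y = w M turns it into the integral of the product of n
    exponential densities. A singular M makes the left-hand side 0. *)
Lemma cone_integral n (M : 'M[R]_n) :
  (`|\det M|%:E * \int[lebesgue_rV n]_w (\prod_i exponential_pdf 1 ((w *m M) ord0 i))%:E
    <= 1)%E.
Proof.
have [->|dM] := eqVneq (\det M) 0; first by rewrite normr0 mul0e.
have r01 : (0 <= 1 :> R) by [].
have mE := @measurable_exponential_pdf R 1.
have E0 := exponential_pdf_ge0 r01.
rewrite (linear_change_unit _ (f := fun w : 'rV[R]_n =>
  (\prod_i exponential_pdf 1 (w ord0 i))%:E)); first last.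
- by move=> w; rewrite lee_fin prodr_ge0.
- by apply/measurable_EFinP; exact: (measurable_prod_coord (h := fun=> exponential_pdf 1)).
- by rewrite unitmxE unitfE.
rewrite (ge0_integral_lebesgue_rV_prod (h := fun=> exponential_pdf 1))// big1// => i _.
by rewrite integral_exponential_pdf.
Qed.

Lemma parallelepiped_integral n (J : 'M[R]_n) (w0 : 'rV[R]_n) (r : 'I_n -> R) :
  J \in unitmx -> (forall i, 0 <= r i) ->
  (`|\det J|%:E * \int[lebesgue_rV n]_w
     (\prod_i \1_(`[- r i, r i]%classic : set R) (((w - w0) *m J) ord0 i))%:E
   = (\prod_i (2 * r i))%:E)%E.
Proof.
move=> uJ r0.
pose G (w : 'rV[R]_n) : \bar R := (\prod_i \1_(`[- r i, r i]%classic : set R) (w ord0 i))%:E.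
have mG : measurable_fun setT G.
  by apply/measurable_EFinP; apply: (measurable_prod_coord
    (h := fun i => \1_`[- r i, r i]%classic)) => i;
    exact: measurable_indic.
have G0 w : (0 <= G w)%E.
  by rewrite lee_fin prodr_ge0// => i _; rewrite indicE.
have mGJ : measurable_fun setT (fun w => G (w *m J)).
  by apply: measurableT_comp => //; exact: measurable_mulmx.
have /= := ge0_integral_lebesgue_rV_translate (- w0) mGJ (fun w => G0 (w *m J)).
move=> ->; rewrite (linear_change_unit uJ mG G0)
  (ge0_integral_lebesgue_rV_prod (h := fun i => \1_`[- r i, r i]%classic))//.
rewrite -prodEFin; apply: eq_bigr => i _.
transitivity (leb `[- r i, r i]%classic); first by rewrite integral_indic// setIT.
rewrite lebesgue_measure_itv/= lte_fin.
have [_|] := ltP (- r i) (r i); first by rewrite -EFinB; congr (_%:E); ring.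
by have := r0 i => ? ?; congr (_%:E); lra.
Qed.

End product_integrals.

(** * The standard normal distribution *)
Section density.
Local Open Scope ereal_scope.
Context d (T : measurableType d) (R : realType).
Variables (mu nu : {sigma_finite_measure set T -> \bar R}) (g f : T -> R).
Hypotheses (mg : measurable_fun setT g) (g0 : forall x, (0 <= g x)%R).
Hypotheses (mf : measurable_fun setT f) (f0 : forall x, (0 <= f x)%R).
Hypothesis nuE : forall A, measurable A -> nu A = \int[mu]_(x in A) (g x)%:E.
Local Notation leb := (@lebesgue_measure R).

(** Tonelli's theorem applied to the region 0 <= t < f x under the graph of f: the
    slice at height t has nu-measure equal to the integral of g over it, and the
    slice over x has length f x. *)
Lemma ge0_integral_density :
  \int[nu]_x (f x)%:E = \int[mu]_x (f x * g x)%:E.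
Proof.
pose E : set (T * R) := [set z | (0 <= z.2)%R /\ (z.2 < f z.1)%R].
have mE : measurable E.
  rewrite (_ : E = (snd @^-1` `[0%R, +oo[%classic) `&`
                   [set z | (z.2 < f z.1)%R]); last first.
    by apply/seteqP; split=> z /=; rewrite in_itv/= andbT.
  apply: measurableI.
    by rewrite -[X in measurable X]setTI; exact: measurable_snd.
  have ml : measurable_fun setT (fun z : T * R => z.2 < f z.1)%R.
    apply: measurable_fun_ltr; first exact: measurable_snd.
    by apply: measurableT_comp => //; exact: measurable_fst.
  by have := ml measurableT [set true] Logic.I; rewrite setTI.
have layer x : \int[leb]_t (\1_E (x, t))%:E = (f x)%:E.
  transitivity (leb `[0%R, f x[%classic).
    rewrite -[in RHS](setIT `[0%R, f x[%classic) -integral_indic//.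
    apply: eq_integral => t _; rewrite !indicE; congr ((_ : bool)%:R%:E).
    by apply/idP/idP; rewrite !inE /E/= in_itv/= => /andP.
  rewrite lebesgue_measure_itv/= lte_fin oppr0 adde0.
  by have := f0 x; case: ltP => // ? ?; congr _%:E; apply/eqP; rewrite eq_le; apply/andP.
have mE1 : measurable_fun setT (fun z : T * R => (\1_E z : R)%:E).
  by apply/measurable_EFinP; exact: measurable_indic.
transitivity (\int[nu]_x \int[leb]_t (\1_E (x, t))%:E).
  by apply: eq_integral => x _; rewrite layer.
rewrite (fubini_tonelli (m1 := nu) (m2 := leb) _ mE1)//.
have mE2 : measurable_fun setT (fun z : T * R => (\1_E z * g z.1)%:E).
  apply/measurable_EFinP; apply: measurable_funM; first exact: measurable_indic.
  by apply: measurableT_comp => //; exact: measurable_fst.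
transitivity (\int[leb]_t \int[mu]_x (\1_E (x, t) * g x)%:E).
  apply: eq_integral => t _.
  have mEt : measurable [set x | E (x, t)].
    by have := @measurable_pair2 _ _ T R t measurableT _ mE; rewrite setTI.
  transitivity (nu [set x | E (x, t)]).
    rewrite -[in RHS](setIT [set x | _]) -integral_indic//.
  rewrite nuE// [LHS]integral_mkcond; apply: eq_integral => x _.
  rewrite patchE indicE; case: ifPn; rewrite ?inE ?notin_setE/= => h.
    by rewrite mem_set// mul1r.
  by rewrite memNset// mul0r.
rewrite -(fubini_tonelli (m1 := mu) (m2 := leb) _ mE2)//; last first.
  by move=> z; rewrite lee_fin mulr_ge0.
apply: eq_integral => x _.
transitivity (\int[leb]_t ((g x)%:E * (\1_E (x, t))%:E)).
  by apply: eq_integral => t _; rewrite -EFinM mulrC.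
rewrite ge0_integralZl//.
- by rewrite layer -EFinM mulrC.
- by have := measurableT_comp mE1 (@measurable_pair1 _ _ T R x).
- by rewrite lee_fin.
Qed.

End density.

Section standard_normal.
Context {R : realType}.
Local Notation leb := (@lebesgue_measure R).
Local Notation gamma := (@normal_prob R 0 1).
Local Notation peak := (@normal_peak R 1).

Lemma normal_peak1E : peak = (Num.sqrt (2 * pi))^-1.
Proof. by rewrite /normal_peak expr1n mul1r mulr_natl. Qed.

(** The normal density is bounded by its value at the mean, and the band is an
    interval of length 2 delta / b. *)
Lemma normal_prob_band (b g delta : R) : 0 < b -> 0 <= delta ->
  (gamma [set x : R | (`|b * x + g| <= delta)%R] <= (peak * (2 * delta / b))%:E)%E.
Proof.
move=> b0 d0.
have -> : [set x : R | `|b * x + g| <= delta] = `[(- delta - g) / b, (delta - g) / b]%classic.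
  apply/seteqP; split=> x /=; rewrite in_itv/= ler_norml ler_pdivrMr// ler_pdivlMr//;
    by move=> /andP[? ?]; apply/andP; split; lra.
set S := `[_, _]%classic.
have mS : measurable (S : set (measurableTypeR R)) by exact: measurable_itv.
apply: (@le_trans _ _ (\int[leb]_(x in S) peak%:E)%E).
  apply: ge0_le_integral => //.
  - by move=> x _; rewrite lee_fin normal_pdf_ge0.
  - by apply/measurable_EFinP; apply: measurable_funTS; exact: measurable_normal_pdf.
  - by move=> x _; rewrite lee_fin normal_pdf_ub// oner_neq0.
rewrite integral_cst// EFinM lee_wpmul2l ?lee_fin ?normal_peak_ge0//.
rewrite [leLHS](lebesgue_measure_itv `[(- delta - g) / b, (delta - g) / b])/= lte_fin.
case: ifPn => _; rewrite ?lee_fin ?divr_ge0 ?mulr_ge0// ?(ltW b0)//.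
by rewrite -mulrBl ler_pM2r ?invr_gt0//; lra.
Qed.

(** By symmetry this is twice the integral of x e^(- x^2 / 2) over x >= 0, which
    has the antiderivative - e^(- x^2 / 2). *)
Lemma integral_abs_normal_fun :
  (\int[leb]_x (`|x| * normal_fun 0 1 x)%:E = 2%:E)%E.
Proof.
pose f (x : R) := `|x| * normal_fun 0 1 x.
pose F (x : R) := - normal_fun 0 1 x.
have nE x : normal_fun 0 1 x = expR (- (x ^+ 2 / 2)) :> R.
  by rewrite /normal_fun subr0 expr1n mulNr.
have cn : continuous (normal_fun 0 1 : R -> R).
  rewrite (_ : normal_fun 0 1 = (fun x => expR (- (x ^+ 2 / 2)))); last exact/funext.
  move=> x; apply: (@continuous_comp _ _ _ (fun x : R => - (x ^+ 2 / 2)) expR).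
    apply: cvgN; apply: cvgMl.
    exact: exprn_continuous.
  exact: continuous_expR.
have cf : continuous f.
  by move=> x; apply: continuousM; [exact: norm_continuous|exact: cn].
have f0 x : 0 <= f x by rewrite mulr_ge0// normal_fun_ge0.
have dF (x : R) : is_derive x 1 F (x * normal_fun 0 1 x).
  rewrite /F (_ : normal_fun 0 1 = (fun x => expR (- (x ^+ 2 / 2)))); last exact/funext.
  apply: is_derive_eq.
  by rewrite /GRing.scale/=; field.
rewrite (ge0_symfun_integralT f0 cf); last first.
  by move=> x; rewrite /f/= normrN !nE sqrrN.
rewrite -set_itvcy.
transitivity (2%:E * \int[leb]_(x in `[0%R, +oo[) (x * normal_fun 0 1 x)%:E)%E.
  congr (_ * _)%E; apply: eq_integral => x; rewrite inE/= in_itv/= andbT => x0.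
  by rewrite /f ger0_norm.
rewrite (@ge0_continuous_FTC2y _ _ F 0 0).
- by rewrite /F nE expr0n/= mul0r oppr0 expR0 -EFinB -EFinM sub0r opprK mulr1.
- by move=> x x0; rewrite mulr_ge0// normal_fun_ge0.
- apply: continuous_subspaceT => x; apply: continuousM; [exact: cvg_id|exact: cn].
- have L : normal_fun 0 1 x @[x --> +oo%R] --> (0 : R).
    under eq_fun do rewrite nE.
    apply: (@cvg_comp _ _ _ (fun x : R => x ^+ 2 / 2) (fun z => expR (- z)) _ (pinfty_nbhs R));
      last exact: cvgr_expR.
    rewrite (_ : (fun x => x ^+ 2 / 2) = (fun y => 2^-1 * y) \o (fun x => x ^+ 2)); last first.
      by apply/funext => x; rewrite /= mulrC.
    apply: (@cvg_comp _ _ _ _ _ _ (pinfty_nbhs R)); first exact: cvgr_expr2.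
    exact: gt0_cvgMry.
  have H := cvgN L; rewrite oppr0 in H; exact: H.
- by move=> x _; have := dF x; case.
- by apply: cvg_at_right_filter; apply: cvgN; exact: cn.
- by move=> x _; rewrite derive1E; have := dF x; case.
Qed.

(** The exact value is 2 / sqrt (2 pi), which is at most 1 since pi >= 2. *)
Lemma integral_abs_normal_prob : (\int[gamma]_x (`|x|)%:E <= 1)%E.
Proof.
rewrite (ge0_integral_density (mu := leb) (g := normal_pdf 0 1))//; last 2 first.
- exact: measurable_normal_pdf.
- by move=> x; exact: normal_pdf_ge0.
have -> : (\int[leb]_x (`|x| * normal_pdf 0 1 x)%:E =
    \int[leb]_x (peak%:E * (`|x| * normal_fun 0 1 x)%:E))%E.
  apply: eq_integral => x _; rewrite normal_pdfE ?oner_neq0// -EFinM.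
  by congr _%:E; ring.
rewrite ge0_integralZl//; last 3 first.
- apply/measurable_EFinP; apply: measurable_funM; first exact: normr_measurable.
  exact: measurable_normal_fun.
- by move=> x _; rewrite lee_fin mulr_ge0// normal_fun_ge0.
- by rewrite lee_fin normal_peak_ge0.
rewrite integral_abs_normal_fun -EFinM lee_fin normal_peak1E mulrC.
have pi2 := pi_ge2 R.
rewrite ler_pdivrMr ?mul1r ?sqrtr_gt0; last by lra.
rewrite -[leLHS]ger0_norm// -sqrtr_sqr ler_sqrt; nra.
Qed.

End standard_normal.

(** * Integrating out one of several independent variables *)
Section elimination.
Context {d : measure_display} {Omega : measurableType d} {R : realType}.
Context {P : probability Omega R} {K : finType} (X : K -> {RV P >-> R}).
Hypothesis X_indep : mutually_independent X.
Variable k : K.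

(** These sets form a pi-system generating the sigma-algebra of the variables
    other than X k. *)
Definition cylinders_off : set (set Omega) :=
  [set S | exists2 B : K -> set R, (forall j, measurable (B j)) &
     S = \bigcap_(j in [set j | j != k]) X j @^-1` B j].

(** The sample space with that smaller sigma-algebra: a function that depends on
    X j for j != k only is measurable on it. *)
Definition off_type := g_sigma_algebraType cylinders_off.
HB.instance Definition _ := Measurable.on off_type.

Lemma cylinders_off_measurable : cylinders_off `<=` measurable.
Proof.
move=> _ [B mB ->].
apply: fin_bigcap_measurable; first exact: finite_finset.
by move=> j _; rewrite -[X in measurable X]setTI; apply: measurable_funPT.
Qed.

Lemma measurable_off_id : measurable_fun setT (id : Omega -> off_type).
Proof.
move=> _ A mA; rewrite setTI preimage_id.
apply: (smallest_sub (@sigma_algebra_measurable _ Omega) cylinders_off_measurable).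
exact: mA.
Qed.

Lemma measurable_off_coord j : j != k -> measurable_fun setT (X j : off_type -> R).
Proof.
move=> jk _ B mB; rewrite setTI; apply: sub_sigma_algebra.
exists (fun i => if i == j then B else setT); first by move=> i; case: ifP.
apply/seteqP; split=> om /=; last by move/(_ j jk); rewrite eqxx.
by move=> XB i _; case: eqP => // ->.
Qed.

(** For cylinders this is the product rule applied to the whole family; both sides
    being finite measures in S, it extends to the generated sigma-algebra. *)
Lemma indep_off (B : set R) (S : set Omega) : measurable B -> <<s cylinders_off >> S ->
  P (S `&` X k @^-1` B) = (P (X k @^-1` B) * P S)%E.
Proof.
move=> mB sS.
have mXB : measurable (X k @^-1` B).
  by rewrite -[X in measurable X]setTI; apply: measurable_funPT.
have pfin : P (X k @^-1` B) \is a fin_num by exact: fin_num_measure.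
have r0 : 0 <= fine (P (X k @^-1` B)) by exact: fine_ge0.
have off0 : cylinders_off setT.
  exists (fun=> setT) => //; apply/seteqP; split=> //.
transitivity (mrestr P mXB S) => //.
transitivity (mscale (NngNum r0) P S); last by rewrite /mscale/= fineK.
apply: (g_sigma_algebra_measure_unique cylinders_off cylinders_off_measurable
  (fun=> setT)) => //.
- by rewrite bigcup_const//; exists 0%N.
- move=> _ _ [B1 mB1 ->] [B2 mB2 ->]; exists (fun j => B1 j `&` B2 j).
    by move=> j; exact: measurableI.
  apply/seteqP; split=> om /=.
    by move=> [h1 h2] j jk; split; [exact: h1|exact: h2].
  by move=> h; split=> j jk; have [] := h j jk.
- move=> _ [C mC ->]; rewrite /= /mrestr /mscale /= fineK//.
  have full D : measurable D ->
      P (\bigcap_(j in [set j | j != k]) X j @^-1` C j `&` X k @^-1` D) =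
      (P (X k @^-1` D) * \prod_(j | j != k) P (X j @^-1` C j))%E.
    move=> mD.
    pose C' j := if j == k then D else C j.
    have mC' j : measurable (C' j) by rewrite /C'; case: ifP.
    have hT j : [set` [set: K]%SET] j by rewrite /= inE.
    transitivity (P (\bigcap_(j in [set` [set: K]%SET]) X j @^-1` C' j)).
      congr (P _); apply/seteqP; split=> om /=.
        by move=> [h1 h2] j _; rewrite /C'; case: eqVneq => [->//|jk]; exact: h1.
      move=> h; split; last by have := h k (hT k); rewrite /C' eqxx.
      by move=> j /= jk; have := h j (hT j); rewrite /C' (negbTE jk).
    rewrite X_indep// (bigD1 k) ?inE//= {1}/C' eqxx; congr (_ * _)%E.
    apply: eq_big => [j|j /andP[_ jk]]; first by rewrite inE.
    by rewrite /C' (negbTE jk).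
  rewrite full//; congr (_ * _)%E.
  (* the cylinder alone is the same rule with the trivial condition on X k *)
  have := full setT measurableT; rewrite preimage_setT setIT probability_setT mul1e.
  by move->.
- by move=> _; rewrite /= /mrestr setTI -ge0_fin_numE.
Qed.

Hypothesis X_gauss : standard_gaussian (X k).
Local Notation gamma := (@normal_prob R 0 1).

(** The pair (X k, identity on [off_type]) has the product of the normal
    distribution and of P as its law, because of [indep_off]; then Tonelli's
    theorem applies. *)
Lemma ge0_integral_eliminate (phi : R * off_type -> \bar R) :
  measurable_fun setT phi -> (forall z, 0 <= phi z)%E ->
  (\int[P]_om phi (X k om, om) =
   \int[P]_om \int[gamma]_x phi (x, om))%E.
Proof.
move=> mphi phi0.
have mXk : measurable_fun setT (X k : Omega -> R) by []. 
pose idm : {mfun Omega >-> off_type} := mfun_Sub (mem_set measurable_off_id).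
pose Q : probability off_type R := distribution P idm.
have mPhi : measurable_fun setT (fun om => (X k om : measurableTypeR R, om : off_type)).
  by apply: measurable_fun_pair; [exact: mXk|exact: measurable_off_id].
transitivity (\int[pushforward P (fun om =>
  (X k om : measurableTypeR R, om : off_type))]_z phi z)%E.
  by rewrite ge0_integral_pushforward.
transitivity (\int[gamma \x Q]_z phi z)%E.
  apply: eq_measure_integral => A mA _; apply/esym/product_measure_unique => //.
  move=> B S mB mS /=.
  rewrite -X_gauss// /distribution /pushforward.
  rewrite -indep_off//; congr (P _).
  by apply/seteqP; split=> om /=[].
rewrite fubini_tonelli2//.
have mG := measurable_fun_fubini_tonelli_G (m1 := gamma) phi mphi phi0.
rewrite [LHS](ge0_integral_distribution idm mG)//.
by move=> y; exact: integral_ge0.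
Qed.

End elimination.

Section expectation.
Context {d : measure_display} {Omega : measurableType d} {R : realType}.
Context {P : probability Omega R} {K : finType} (X : K -> {RV P >-> R}).
Hypothesis X_indep : mutually_independent X.
Hypothesis X_gauss : forall k, standard_gaussian (X k).
Local Notation gamma := (@normal_prob R 0 1).
Local Notation peak := (@normal_peak R 1).

(** Given the other variables, b X k + G falls in [- delta, delta] with
    probability at most the maximum of the normal density times the length
    2 delta / b. *)
Lemma integral_elim_band k (b delta : R) (G Z : Omega -> R) : 0 < b -> 0 <= delta ->
  measurable_fun setT (G : off_type X k -> R) ->
  measurable_fun setT (Z : off_type X k -> R) -> (forall om, 0 <= Z om) ->
  (\int[P]_om (\1_(`[- delta, delta]%classic : set R) (b * X k om + G om) * Z om)%:E
   <= (peak * (2 * delta / b))%:E * \int[P]_om (Z om)%:E)%E.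
Proof.
move=> b0 d0 mG mZ Z0.
pose phi (z : R * off_type X k) : \bar R :=
  (\1_(`[- delta, delta]%classic : set R) (b * z.1 + G z.2) * Z z.2)%:E.
have mband : measurable_fun setT (fun z : R * off_type X k => b * z.1 + G z.2).
  apply: measurable_funD; first by apply: measurable_funM => //; exact: measurable_fst.
  by apply: measurableT_comp => //; exact: measurable_snd.
have mphi : measurable_fun setT phi.
  apply/measurable_EFinP; apply: measurable_funM.
    by apply: measurableT_comp mband; exact: measurable_indic.
  by apply: measurableT_comp => //; exact: measurable_snd.
have phi0 z : (0 <= phi z)%E by rewrite lee_fin mulr_ge0.
have c0 : 0 <= peak * (2 * delta / b).
  by rewrite mulr_ge0 ?normal_peak_ge0// divr_ge0 ?mulr_ge0// ltW.
rewrite -[leLHS]/(\int[P]_om phi (X k om, om))%E ge0_integral_eliminate//.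
have mZO : measurable_fun setT (Z : Omega -> R).
  by apply: (measurableT_comp mZ); exact: measurable_off_id.
rewrite -ge0_integralZl//; last 2 first.
- exact/measurable_EFinP.
- by move=> om _; rewrite lee_fin.
apply: ge0_le_integral => //.
- by move=> om _; exact: integral_ge0.
- have mI := measurable_fun_fubini_tonelli_G (m1 := gamma) phi mphi phi0.
  by apply: (measurableT_comp mI); exact: measurable_off_id.
- by apply/measurable_EFinP; apply: measurable_funM.
move=> om _.
have -> : (\int[gamma]_x phi (x, om) =
  (Z om)%:E * gamma [set x : R | (`|b * x + G om| <= delta)%R])%E.
  transitivity (\int[gamma]_x ((Z om)%:E * (\1_[set x : R | `|b * x + G om| <= delta] x)%:E))%E.
    apply: eq_integral => x _; rewrite /phi/= mulrC EFinM; congr (_ * _%:E)%E.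
    rewrite !indicE; congr ((_ : bool)%:R).
    by apply/idP/idP; rewrite !inE/= in_itv/= ler_norml.
  have mS : measurable ([set x : R | `|b * x + G om| <= delta] : set (measurableTypeR R)).
    have mb : measurable_fun setT (fun x : R => b * x + G om).
      by apply: measurable_funD => //; exact: measurable_funM.
    have := mb measurableT _ (measurable_itv `[- delta, delta]).
    rewrite setTI; congr (measurable _); apply/seteqP; split=> x /=; by rewrite in_itv/= ler_norml.
  rewrite ge0_integralZl//; last 2 first.
  - by apply/measurable_EFinP; exact: measurable_indic.
  - by rewrite lee_fin.
  by rewrite integral_indic// setIT.
rewrite muleC lee_wpmul2r ?lee_fin//.
exact: normal_prob_band.
Qed.

Lemma integral_elim_abs k (Z : Omega -> R) :
  measurable_fun setT (Z : off_type X k -> R) -> (forall om, 0 <= Z om) ->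
  (\int[P]_om (`|X k om| * Z om)%:E <= \int[P]_om (Z om)%:E)%E.
Proof.
move=> mZ Z0.
pose phi (z : R * off_type X k) : \bar R := (`|z.1| * Z z.2)%:E.
have mphi : measurable_fun setT phi.
  apply/measurable_EFinP; apply: measurable_funM.
    by apply: measurableT_comp; [exact: normr_measurable|exact: measurable_fst].
  by apply: measurableT_comp => //; exact: measurable_snd.
have phi0 z : (0 <= phi z)%E by rewrite lee_fin mulr_ge0.
rewrite -[leLHS]/(\int[P]_om phi (X k om, om))%E ge0_integral_eliminate//.
have mZO : measurable_fun setT (Z : Omega -> R).
  by apply: (measurableT_comp mZ); exact: measurable_off_id.
apply: ge0_le_integral => //.
- by move=> om _; exact: integral_ge0.
- have mI := measurable_fun_fubini_tonelli_G (m1 := gamma) phi mphi phi0.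
  by apply: (measurableT_comp mI); exact: measurable_off_id.
- exact/measurable_EFinP.
move=> om _.
have -> : (\int[gamma]_x phi (x, om) = (Z om)%:E * \int[gamma]_x (`|x|)%:E)%E.
  transitivity (\int[gamma]_x ((Z om)%:E * (`|x|)%:E))%E.
    by apply: eq_integral => x _; rewrite /phi/= mulrC EFinM.
  rewrite ge0_integralZl//; last by rewrite lee_fin.
  by apply/measurable_EFinP; exact: normr_measurable.
rewrite -[leRHS]mule1 lee_wpmul2l ?lee_fin//.
exact: integral_abs_normal_prob.
Qed.

Lemma measurable_off_prod_abs k (I : eqType) (g : I -> K) (s : seq I) :
  (forall i, i \in s -> g i != k) ->
  measurable_fun setT ((fun om => \prod_(i <- s) `|X (g i) om|) : off_type X k -> R).
Proof.
move=> gk; apply: measurable_prod => i si.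
apply: measurableT_comp; first exact: normr_measurable.
by apply: measurable_off_coord; exact: gk.
Qed.

Lemma expectation_prod_abs (I : eqType) (g : I -> K) (s : seq I) :
  injective g -> uniq s ->
  (\int[P]_om (\prod_(i <- s) `|X (g i) om|)%:E <= 1)%E.
Proof.
move=> ginj; elim: s => [|i s IH] /=.
  by move=> _; under eq_integral do rewrite big_nil; rewrite integral_cst//= probability_setT mule1.
move=> /andP[si us]; apply: le_trans (IH us).
under eq_integral do rewrite big_cons.
apply: integral_elim_abs; last by move=> om; apply: prodr_ge0.
apply: measurable_off_prod_abs => j sj; rewrite (inj_eq ginj).
by apply: contraNneq si => <-.
Qed.

(** The variables X (f i) are integrated out one after the other, each of them
    occurring in a single band condition; the remaining product of the
    |X (g i)| has expectation at most 1. *)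
Lemma expectation_band_prod (I : finType) (f g : I -> K) (b : I -> R) (delta : R)
    (G : I -> Omega -> R) : injective f -> injective g -> (forall i j, f i != g j) ->
  (forall i, 0 < b i) -> 0 <= delta ->
  (forall i j, measurable_fun setT (G i : off_type X (f j) -> R)) ->
  (\int[P]_om (\prod_i \1_(`[- delta, delta]%classic : set R) (b i * X (f i) om + G i om)
      * \prod_i `|X (g i) om|)%:E
   <= (\prod_i (peak * (2 * delta / b i)))%:E)%E.
Proof.
move=> finj ginj fg b0 d0 mG.
have c0 i : 0 <= peak * (2 * delta / b i).
  by rewrite mulr_ge0 ?normal_peak_ge0// divr_ge0 ?mulr_ge0// ltW.
have H0 om : 0 <= \prod_i `|X (g i) om| by exact: prodr_ge0.
rewrite -[leRHS]mule1.
apply: (@le_trans _ _ ((\prod_i (peak * (2 * delta / b i)))%:E *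
    \int[P]_om (\prod_i `|X (g i) om|)%:E)%E); last first.
  rewrite lee_wpmul2l ?lee_fin ?prodr_ge0//.
  by apply: expectation_prod_abs => //; exact: index_enum_uniq.
suff main (s : seq I) : uniq s -> (\int[P]_om (\prod_(i <- s)
   \1_(`[- delta, delta]%classic : set R) (b i * X (f i) om + G i om)
      * \prod_i `|X (g i) om|)%:E <= (\prod_(i <- s) (peak * (2 * delta / b i)))%:E *
      \int[P]_om (\prod_i `|X (g i) om|)%:E)%E.
  by apply: main; exact: index_enum_uniq.
elim: s => [_|i s IH /= /andP[si us]].
  by under eq_integral do rewrite big_nil mul1r; rewrite big_nil mul1e.
rewrite big_cons EFinM -muleA.
apply: (@le_trans _ _ ((peak * (2 * delta / b i))%:E * \int[P]_om (\prod_(j <- s)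
   \1_(`[- delta, delta]%classic : set R) (b j * X (f j) om + G j om)
      * \prod_i `|X (g i) om|)%:E)%E); last first.
  by rewrite lee_wpmul2l ?lee_fin//; exact: IH.
under eq_integral do rewrite big_cons -mulrA.
apply: integral_elim_band => //; last first.
  by move=> om; rewrite mulr_ge0// prodr_ge0// => j _; rewrite indicE.
apply: measurable_funM; last first.
  by apply: measurable_off_prod_abs => j _; rewrite eq_sym.
apply: measurable_prod => j sj.
have mbj : measurable_fun setT
    ((fun om => b j * X (f j) om + G j om) : off_type X (f i) -> R).
  apply: measurable_funD => //; apply: measurable_funM => //.
  apply: measurable_off_coord; rewrite (inj_eq finj).
  by apply: contraNneq si => <-.
by apply: measurableT_comp mbj; exact: measurable_indic.
Qed.

End expectation.

(** * Exponential sums on normal cones *)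

(** Multilinearity of the determinant in its columns, each of which is a linear
    combination of vectors. *)
Lemma det_sum_expand (R : comNzRingType) n (K : finType) (Q : 'I_n -> pred K)
    (x : 'I_n -> K -> R) (v : 'I_n -> K -> 'rV[R]_n) :
  \det (\matrix_(j, i) \sum_(k | Q i k) x i k * v i k 0 j) =
  \sum_(g in family Q) (\prod_i x i (g i)) * \det (\matrix_(j, i) v i (g i) 0 j).
Proof.
rewrite -[LHS]det_tr [in LHS]/determinant.
under eq_bigr => s _.
  under eq_bigr => i _ do rewrite !mxE.
  rewrite bigA_distr_big_dep big_distrr/=.
  over.
rewrite exchange_big/=; apply: eq_bigr => g _.
rewrite -det_tr /determinant big_distrr/=; apply: eq_bigr => s _.
rewrite mulrCA; congr (_ * _); rewrite -big_split/=.
by apply: eq_bigr => i _; rewrite !mxE.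
Qed.

(** The coefficients of all equations are indexed by one finite type K; the term k
    belongs to the equation t k and has the exponent vector p k. A selection is a
    function f with t (f i) = i. *)
Section system.
Context {R : realType} {n : nat} {K : finType}.
Variables (t : K -> 'I_n) (p : K -> 'rV[R]_n).
Implicit Types (c : K -> R) (w : 'rV[R]_n) (f g : 'I_n -> K).

Definition term k w : R := expR (dotv (p k) w).

Definition system c w (i : 'I_n) : R := \sum_(k | t k == i) c k * term k w.

(** Up to the factors e^<p (f i), w>, the transposed Jacobian matrix of the system
    whose i-th equation has been divided by its term f i. *)
Definition jacmx c w f : 'M[R]_n :=
  \matrix_(j, i) \sum_(k | t k == i) c k * term k w * (p k - p (f i)) 0 j.

Definition edges f g : 'M[R]_n := \matrix_(j, i) (p (g i) - p (f i)) 0 j.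

Definition choices f : 'I_n -> pred K := fun i k => (t k == i) && (k != f i).

Definition cone f : set 'rV[R]_n :=
  [set w | forall i k, t k = i -> dotv (p k) w <= dotv (p (f i)) w].

Lemma term_gt0 k w : 0 < term k w. Proof. exact: expR_gt0. Qed.

(** The term k = f i has the zero vector p k - p (f i) and drops out of column i,
    so that only the choices g with g i != f i remain. *)
Lemma det_jacmx_le c w f :
  `|\det (jacmx c w f)| <= \sum_(g in family (choices f))
     (\prod_i `|c (g i)|) * (\prod_i term (g i) w) * `|\det (edges f g)|.
Proof.
have -> : jacmx c w f = \matrix_(j, i) \sum_(k | choices f i k)
    (c k * term k w) * (p k - p (f i)) 0 j.
  apply/matrixP => j i; rewrite !mxE [in RHS]big_mkcondr/=; apply: eq_bigr => k _.
  by case: eqVneq => // ->; rewrite subrr mxE mulr0.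
rewrite (det_sum_expand (choices f) (fun _ k => c k * term k w) (fun i k => p k - p (f i))).
apply: le_trans (ler_norm_sum _ _ _) _; apply: ler_sum => g _.
rewrite normrM ler_wpM2r// normr_prod -big_split/=.
by apply: ler_prod => i _; rewrite normr_ge0/= normrM (ger0_norm (ltW (term_gt0 _ _))).
Qed.

Lemma dotvBl (u v w : 'rV[R]_n) : dotv (u - v) w = dotv u w - dotv v w.
Proof.
by rewrite /dotv -sumrB; apply: eq_bigr => j _; rewrite !mxE mulrBl.
Qed.

Lemma edges_mulmx f g w i : (w *m edges f g) 0 i = dotv (p (g i)) w - dotv (p (f i)) w.
Proof.
rewrite -dotvBl mxE /dotv; apply: eq_bigr => j _.
by rewrite mxE mulrC.
Qed.

Lemma measurable_dotv (u : 'rV[R]_n) : measurable_fun setT (dotv u).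
Proof.
apply: measurable_sum => j; apply: measurable_funM => //; exact: measurable_coord.
Qed.

Lemma measurable_term k : measurable_fun setT (term k).
Proof.
by apply: measurableT_comp; [exact: measurable_expR|exact: measurable_dotv].
Qed.

Lemma measurable_cone f : measurable (cone f).
Proof.
have -> : cone f = \bigcap_(k in [set: K])
    (fun w => dotv (p (f (t k))) w - dotv (p k) w) @^-1` `[0, +oo[%classic.
  apply/seteqP; split=> w /=.
    by move=> h k _ /=; rewrite in_itv/= andbT subr_ge0; exact: h.
  by move=> h i k <-; have := h k Logic.I; rewrite /= in_itv/= andbT subr_ge0.
apply: fin_bigcap_measurable; first exact: finite_finset.
move=> k _; rewrite -[X in measurable X]setTI.
by apply: measurable_funB => //; exact: measurable_dotv.
Qed.

(** On the cone of f the coordinates <p (f i) - p (g i), w> are nonnegative, and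
    the integrand is the product of exponential densities in [cone_integral]. *)
Lemma cone_edges_integral f g : (forall i, t (g i) = i) ->
  (`|\det (edges f g)|%:E *
   \int[lebesgue_rV n]_w (\1_(cone f) w * \prod_i expR (dotv (p (g i)) w - dotv (p (f i)) w))%:E
   <= 1)%E.
Proof.
move=> tg; have -> : `|\det (edges f g)| = `|\det (edges g f)|.
  have -> : edges g f = - edges f g.
    by apply/matrixP => j i; rewrite !mxE opprB.
  by rewrite -scaleN1r detZ normrM normrX normrN1 expr1n mul1r.
apply: le_trans (cone_integral (edges g f)).
apply: lee_wpmul2l => //.
apply: ge0_le_integral => //.
- by move=> w _; rewrite lee_fin mulr_ge0// prodr_ge0// => i _; exact: expR_ge0.
- apply/measurable_EFinP; apply: measurable_funM.
    by apply: measurable_indic; exact: measurable_cone.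
  apply: measurable_prod => i _; apply: measurableT_comp; first exact: measurable_expR.
  by apply: measurable_funB; exact: measurable_dotv.
- apply/measurable_EFinP; apply: (@measurableT_comp _ _ _ _ _ _
    (fun w : 'rV[R]_n => \prod_i exponential_pdf 1 (w 0 i)) _ (fun w => w *m edges g f)).
    by apply: (measurable_prod_coord (h := fun=> exponential_pdf 1)) => i;
      exact: measurable_exponential_pdf.
  exact: measurable_mulmx.
move=> w _; rewrite lee_fin indicE.
have [/set_mem wf|_] := boolP (w \in cone f); last first.
  by rewrite mul0r prodr_ge0// => i _; exact: exponential_pdf_ge0.
rewrite mul1r; apply: ler_prod => i _; rewrite expR_ge0/=.
rewrite edges_mulmx exponential_pdfE ?subr_ge0; last by apply: wf; rewrite tg.
by rewrite mul1r mulN1r opprB.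
Qed.

End system.

(** * Expectation of the Kac integrals *)
Section kac_density.
Context {R : realType} {n : nat} {K : finType}.
Variables (t : K -> 'I_n) (p : K -> 'rV[R]_n).

Definition kac_density (delta : R) (f : 'I_n -> K) (c : K -> R) (w : 'rV[R]_n) : R :=
  \1_(cone t p f) w *
  (\prod_i \1_(`[- delta, delta]%classic : set R) (system t p c w i) *
   `|\det (jacmx t p c w f)|).

Lemma kac_density_ge0 delta f c w : 0 <= kac_density delta f c w.
Proof. by rewrite /kac_density !mulr_ge0// prodr_ge0// => i _; rewrite indicE. Qed.

Section measurability.
Context d (S : measurableType d) (c : S -> K -> R) (w : S -> 'rV[R]_n).
Hypothesis mc : forall k, measurable_fun setT (c ^~ k).
Hypothesis mw : measurable_fun setT w.

Let mterm k : measurable_fun setT (fun z => term p k (w z)).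
Proof. by apply: measurableT_comp mw; exact: measurable_term. Qed.

Lemma measurable_system i : measurable_fun setT (fun z => system t p (c z) (w z) i).
Proof.
rewrite /system; under eq_fun do rewrite big_mkcond.
apply: measurable_sum => k; case: (t k == _); last exact: measurable_cst.
exact: measurable_funM.
Qed.

Lemma measurable_kac_density delta f :
  measurable_fun setT (fun z => kac_density delta f (c z) (w z)).
Proof.
apply: measurable_funM.
  apply: (@measurableT_comp _ _ _ _ _ _ (\1_(cone t p f) : 'rV[R]_n -> R)) => //.
  by apply: measurable_indic; exact: measurable_cone.
apply: measurable_funM.
  apply: measurable_prod => i _.
  by apply: measurableT_comp (measurable_system i); exact: measurable_indic.
apply: measurableT_comp; first exact: normr_measurable.
rewrite /determinant; apply: measurable_sum => s; apply: measurable_funM => //.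
apply: measurable_prod => j _; under eq_fun do rewrite mxE big_mkcond.
apply: measurable_sum => k; case: (t k == _); last exact: measurable_cst.
by apply: measurable_funM => //; exact: measurable_funM.
Qed.

End measurability.

End kac_density.

Section kac_rice.
Context {d : measure_display} {Omega : measurableType d} {R : realType}.
Context {P : probability Omega R} {n : nat} {K : finType}.
Variables (t : K -> 'I_n) (p : K -> 'rV[R]_n) (X : K -> {RV P >-> R}).
Local Notation peak := (@normal_peak R 1).

Hypothesis X_indep : mutually_independent X.
Hypothesis X_gauss : forall k, standard_gaussian (X k).

Lemma measurable_kac_density_joint delta f :
  measurable_fun setT (fun z : Omega * 'rV[R]_n => kac_density t p delta f (X^~ z.1) z.2).
Proof.
apply: (measurable_kac_density t p (c := fun z => X^~ z.1) (w := snd)) => // k.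
by apply: measurableT_comp => //; exact: measurable_fst.
Qed.

(** At a fixed w, the i-th equation is e^<p (f i), w> X (f i) plus terms that do
    not involve any X (f j), so every band condition costs a factor
    2 delta peak e^(- <p (f i), w>); the determinant is expanded by
    [det_jacmx_le]. *)
Lemma expectation_kac_density delta f w : 0 <= delta -> (forall i, t (f i) = i) ->
  (\int[P]_om (kac_density t p delta f (X^~ om) w)%:E <=
   \sum_(g : {ffun 'I_n -> K} | g \in family (choices t f))
   ((2 * delta * peak) ^+ n)%:E * (`|\det (edges p f g)|%:E *
    (\1_(cone t p f) w * \prod_i expR (dotv (p (g i)) w - dotv (p (f i)) w))%:E))%E.
Proof.
move=> d0 tf.
have mk : measurable_fun setT (fun om => kac_density t p delta f (X^~ om) w).
  exact: (measurable_kac_density t p (c := fun om => X^~ om) (w := fun=> w)).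
pose band om : R := \prod_i \1_(`[- delta, delta]%classic : set R) (system t p (X^~ om) w i).
have band0 om : 0 <= band om by rewrite prodr_ge0// => i _; rewrite indicE.
pose C (g : {ffun 'I_n -> K}) : R :=
  \1_(cone t p f) w * (\prod_i term p (g i) w) * `|\det (edges p f g)|.
have C0 g : 0 <= C g.
  by rewrite !mulr_ge0// prodr_ge0// => i _; rewrite ltW// term_gt0.
have mband : measurable_fun setT band.
  apply: measurable_prod => i _.
  have mF : measurable_fun setT (fun om => system t p (X^~ om) w i).
    exact: (measurable_system t p (c := fun om => X^~ om) (w := fun=> w)).
  by apply: measurableT_comp mF; exact: measurable_indic.
have mabs (g : {ffun 'I_n -> K}) : measurable_fun setT (fun om => \prod_i `|X (g i) om|).
  apply: measurable_prod => i _; apply: measurableT_comp => //; exact: normr_measurable.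
have abs0 (g : {ffun 'I_n -> K}) om : 0 <= \prod_i `|X (g i) om| by exact: prodr_ge0.
apply: (@le_trans _ _ (\int[P]_om \sum_(g : {ffun 'I_n -> K} | g \in family (choices t f))
    ((C g)%:E * (band om * \prod_i `|X (g i) om|)%:E))%E).
  apply: ge0_le_integral => //.
  - by move=> om _; rewrite lee_fin kac_density_ge0.
  - exact/measurable_EFinP.
  - under eq_fun do rewrite big_mkcond/=.
    apply: emeasurable_sum => g; case: (g \in _); last exact: measurable_cst.
    apply: emeasurable_funM; first exact: measurable_cst.
    by apply/measurable_EFinP; exact: measurable_funM.
  move=> om _; under eq_bigr do rewrite -EFinM.
  rewrite sumEFin lee_fin /kac_density -/(band om).
  apply: le_trans (ler_wpM2l _ (ler_wpM2l (band0 om) (det_jacmx_le t p (X^~ om) w f))) _.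
    by rewrite indicE.
  rewrite !big_distrr/=; apply: ler_sum => g _;
    rewrite /C le_eqVlt; apply/orP; left; apply/eqP; ring.
under eq_integral do rewrite -big_filter.
rewrite ge0_integral_sum//; last 2 first.
- move=> g; apply: emeasurable_funM; first exact: measurable_cst.
  by apply/measurable_EFinP; exact: measurable_funM.
- by move=> g om _; rewrite mule_ge0 ?lee_fin// mulr_ge0.
rewrite big_filter.
apply: lee_sum => g gf.
rewrite ge0_integralZl//; last 3 first.
- by apply/measurable_EFinP; exact: measurable_funM.
- by move=> om _; rewrite lee_fin mulr_ge0.
- by rewrite lee_fin.
have tg i : t (g i) = i /\ g i != f i by move/familyP/(_ i)/andP: gf => [/eqP].
have finj : injective f by move=> i j /(congr1 t); rewrite !tf.
have ginj : injective g by move=> i j /(congr1 t); rewrite !(tg _).1.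
have fg i j : f i != g j.
  apply/eqP => e; have := congr1 t e; rewrite tf (tg j).1 => ij.
  by have := (tg j).2; rewrite -e ij eqxx.
(* the part of the i-th equation without the selected term *)
pose G i (om : Omega) := \sum_(k | choices t f i k) X k om * term p k w.
have FE om i : system t p (X^~ om) w i = term p (f i) w * X (f i) om + G i om.
  rewrite /system (bigD1 (f i)) ?tf ?eqxx//= mulrC; congr (_ + _).
have E := expectation_band_prod X_indep X_gauss finj ginj fg
  (fun i => term_gt0 p (f i) w) d0 (G := G).
have mG i j : measurable_fun setT (G i : off_type X (f j) -> R).
  rewrite /G; under eq_fun do rewrite big_mkcond/=.
  apply: measurable_sum => k; case kc: (choices t f i k); last exact: measurable_cst.
  have /andP[/eqP tk kf] := kc.
  apply: measurable_funM => //; apply: measurable_off_coord.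
  by apply: contraNneq kf => kj; move: tk; rewrite kj tf => <-.
apply: (@le_trans _ _ ((C g)%:E * (\prod_i (peak * (2 * delta / term p (f i) w)))%:E)%E).
  apply: lee_wpmul2l; first by rewrite lee_fin.
  apply: le_trans (E mG); rewrite le_eqVlt; apply/orP; left; apply/eqP.
  apply: eq_integral => om _; congr (_ * _)%:E.
  by apply: eq_bigr => i _; rewrite FE.
rewrite -!EFinM lee_fin le_eqVlt; apply/orP; left; apply/eqP.
have -> : \prod_i (peak * (2 * delta / term p (f i) w)) =
   (2 * delta * peak) ^+ n * \prod_i (term p (f i) w)^-1.
  have -> : (2 * delta * peak) ^+ n = \prod_(i < n) (2 * delta * peak)
    by rewrite prodr_const card_ord.
  by rewrite -big_split/=; apply: eq_bigr => i _; ring.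
have -> : \prod_i expR (dotv (p (g i)) w - dotv (p (f i)) w) =
   \prod_i term p (g i) w * \prod_i (term p (f i) w)^-1.
  by rewrite -big_split/=; apply: eq_bigr => i _; rewrite expRB.
by rewrite /C; ring.
Qed.

(** Tonelli's theorem exchanges the expectation with the integral over w; each
    choice g then contributes at most (2 delta peak)^n, and there are t_i - 1
    possible values of g i. *)
Lemma integral_kac_density delta f : 0 <= delta -> (forall i, t (f i) = i) ->
  (\int[P]_om \int[lebesgue_rV n]_w (kac_density t p delta f (X^~ om) w)%:E <=
   ((2 * delta * peak) ^+ n * \prod_i (#|[pred k | t k == i]|%:R - 1))%:E)%E.
Proof.
move=> d0 tf.
have mk := measurable_kac_density_joint delta f.
rewrite (fubini_tonelli (m1 := P) (m2 := lebesgue_rV n)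
  (fun z => (kac_density t p delta f (X^~ z.1) z.2)%:E));
  last 2 first.
- exact/measurable_EFinP.
- by move=> z; rewrite lee_fin kac_density_ge0.
have c0 : 0 <= (2 * delta * peak) ^+ n by rewrite exprn_ge0// !mulr_ge0// normal_peak_ge0.
pose h (g : {ffun 'I_n -> K}) w := 
  (\1_(cone t p f) w * \prod_i expR (dotv (p (g i)) w - dotv (p (f i)) w))%:E.
have h0 g w : (0 <= h g w)%E.
  by rewrite lee_fin mulr_ge0// prodr_ge0// => i _; rewrite expR_ge0.
have mh g : measurable_fun setT (h g).
  apply/measurable_EFinP; apply: measurable_funM.
    by apply: measurable_indic; exact: measurable_cone.
  apply: measurable_prod => i _; apply: measurableT_comp; first exact: measurable_expR.
  by apply: measurable_funB; exact: measurable_dotv.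
apply: (@le_trans _ _ (\int[lebesgue_rV n]_w
  \sum_(g : {ffun 'I_n -> K} | g \in family (choices t f))
   (((2 * delta * peak) ^+ n)%:E * (`|\det (edges p f g)|%:E * h g w)))%E).
  apply: ge0_le_integral => //.
  - by move=> w _; apply: integral_ge0 => om _; rewrite lee_fin kac_density_ge0.
  - apply: (measurable_fun_fubini_tonelli_G (m1 := P)
    (fun z => (kac_density t p delta f (X^~ z.1) z.2)%:E)).
      exact/measurable_EFinP.
    by move=> z; rewrite lee_fin kac_density_ge0.
  - under eq_fun do rewrite big_mkcond/=.
    apply: emeasurable_sum => g; case: (g \in _); last exact: measurable_cst.
    by do 2 apply: emeasurable_funM => //.
  - by move=> w _; exact: expectation_kac_density.
under eq_integral do rewrite -big_filter.
rewrite ge0_integral_sum//; last 2 first.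
- by move=> g; do 2 apply: emeasurable_funM => //.
- by move=> g w _; rewrite !mule_ge0.
rewrite big_filter.
apply: (@le_trans _ _ (\sum_(g : {ffun 'I_n -> K} | g \in family (choices t f))
   ((2 * delta * peak) ^+ n)%:E)%E).
  apply: lee_sum => g gf.
  have tg i : t (g i) = i by move/familyP/(_ i)/andP: gf => [/eqP].
  have m1 : measurable_fun setT (fun w => `|\det (edges p f g)|%:E * h g w)%E.
    by apply: emeasurable_funM.
  rewrite ge0_integralZl ?lee_fin//; last by move=> w _; rewrite mule_ge0.
  rewrite ge0_integralZl//.
  by rewrite -[leRHS]mule1 lee_wpmul2l ?lee_fin//; exact: cone_edges_integral.
rewrite sumEFin lee_fin sumr_const -[leLHS]mulr_natr ler_wpM2l//.
rewrite card_family foldrE big_image/= natr_prod.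
apply: ler_prod => i _; rewrite ler0n/=.
rewrite (cardD1 (f i) [pred k | t k == i]) inE tf eqxx natrD addrAC subrr add0r ler_nat.
by apply/subset_leq_card/fintype.subsetP => k; rewrite !inE andbC.
Qed.

End kac_rice.

(** * The Jacobian matrix of the system *)
Lemma is_diff_bigsum (R : realFieldType) (V W : normedModType R) (x : V)
    (I : Type) (s : seq I) (h dh : I -> V -> W) :
  (forall i, is_diff x (h i) (dh i)) ->
  is_diff x (\sum_(i <- s) h i) (\sum_(i <- s) dh i).
Proof.
move=> hd; elim: s => [|i s IH]; first by rewrite !big_nil; exact: is_diff_cst.
by rewrite !big_cons; exact: is_diffD.
Qed.

Section derivative.
Context {R : realType} {n : nat} {K : finType}.
Variables (t : K -> 'I_n) (p : K -> 'rV[R]_n).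
Implicit Types (c : K -> R) (w z : 'rV[R]_n).

Definition system_row c w : 'rV[R]_n := \row_i system t p c w i.

Lemma continuous_dotv (u : 'rV[R]_n) : continuous (dotv u).
Proof.
apply: continuous_big => [|j _ w]; first exact: add_continuous.
by apply: (@continuousM R 'rV[R]_n (fun=> u 0 j) (fun w => w 0 j) w);
  [exact: cst_continuous|exact: coord_continuous].
Qed.

Lemma is_diff_dotv (u z : 'rV[R]_n) : is_diff z (dotv u) (dotv u).
Proof.
have lin_dotv : linear (dotv u).
  move=> a v w; rewrite /dotv scaler_sumr -big_split/=; apply: eq_bigr => j _.
  by rewrite !mxE mulrDr mulrCA.
pose LM := GRing.isLinear.Build _ _ _ _ _ lin_dotv.
pose L : {linear _ -> _} := HB.pack (dotv u) LM.
have -> : dotv u = L by [].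
apply: DiffDef; first exact/linear_differentiable/continuous_dotv.
by rewrite diff_lin //; exact: continuous_dotv.
Qed.

Lemma is_diff_term k z :
  is_diff z (term p k) (fun h => dotv (p k) h * term p k z).
Proof.
have dexp (y : R) : is_diff y expR (fun h => h * expR y).
  apply: DiffDef; first by apply/derivable1_diffP; exact: derivable_expR.
  rewrite diff1E; last by apply/derivable1_diffP; exact: derivable_expR.
  by rewrite derive1E derive_val.
exact: (is_diff_comp (is_diff_dotv (p k) z) (dexp _)).
Qed.

Lemma is_diff_system_row c z : is_diff z (system_row c)
  (\sum_k (fun h => (dotv (p k) h * term p k z) *: (c k *: delta_mx 0 (t k)))).
Proof.
have -> : system_row c =
    \sum_k (fun w => term p k w *: (c k *: delta_mx 0 (t k) : 'rV[R]_n)).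
  apply/funext => w; rewrite fct_sumE; apply/rowP => i.
  rewrite mxE summxE /system [LHS]big_mkcond/=; apply: eq_bigr => k _.
  rewrite !mxE eqxx/= eq_sym; case: eqP => _; last by rewrite !mulr0.
  by rewrite mulr1 mulrC.
apply: is_diff_bigsum => k.
exact: (is_diff_comp (is_diff_term k z) (is_diff_scalel _ _)).
Qed.

Lemma jacobian_system_row c z : 
  'J (system_row c) z = \matrix_(j, i) \sum_(k | t k == i) c k * term p k z * (p k) 0 j.
Proof.
have dF := is_diff_system_row c z.
apply/matrixP => j i; rewrite /jacobian mxE (@diff_val _ _ _ _ _ _ _ dF).
rewrite fct_sumE summxE mxE [RHS]big_mkcond/=; apply: eq_bigr => k _.
have -> : dotv (p k) (delta_mx 0 j) = p k 0 j.
  rewrite /dotv (bigD1 j)//= mxE !eqxx mulr1 big1 ?addr0// => l lj.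
  by rewrite mxE (negbTE lj) andbF mulr0.
rewrite !mxE eqxx/= eq_sym; case: eqP => _; last by rewrite !mulr0.
by rewrite mulr1; ring.
Qed.

(** Replacing p k by p k - p (f i) in column i subtracts F_i p (f i), which
    vanishes at a zero. *)
Lemma jacmx_zero c z f : system_row c z = 0 -> jacmx t p c z f = 'J (system_row c) z.
Proof.
move=> Fz; rewrite jacobian_system_row; apply/matrixP => j i; rewrite !mxE.
have := congr1 (fun v : 'rV[R]_n => v 0 i) Fz; rewrite !mxE /system => Fi.
under eq_bigr do rewrite !mxE mulrBr.
by rewrite sumrB -big_distrl/= Fi mul0r subr0.
Qed.

Lemma taylor_zero c z : system_row c z = 0 -> forall e, 0 < e ->
  \forall w \near z, `|system_row c w - (w - z) *m 'J (system_row c) z| <= e * `|w - z|.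
Proof.
move=> Fz e e0.
have dF := is_diff_system_row c z.
have [[_]] : differentiable (system_row c) z by exact: ex_diff.
move=> /eqaddoP/(_ e e0) H; apply: (@filterS _ (nbhs z) (nbhs_filter z) _ _ _ H) => w /=.
rewrite lim_id// Fz /jacobian mul_rV_lin1 !fctE /=.
by rewrite add0r.
Qed.

Lemma continuous_term k : continuous (term p k).
Proof.
by move=> w; apply: continuous_comp; [exact: continuous_dotv|exact: continuous_expR].
Qed.

Lemma continuous_det_jacmx c f : continuous (fun w => \det (jacmx t p c w f)).
Proof.
have h (s : 'I_n -> 'I_n) : continuous (fun w => \prod_(i < n) jacmx t p c w f i (s i)).
  apply: continuous_big => [|j _]; first exact: mul_continuous.
  under eq_fun do rewrite mxE.
  apply: continuous_big => [|k _ w]; first exact: add_continuous.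
  apply: (@continuousM R 'rV[R]_n (fun w => c k * term p k w) (fun=> _) w);
    last exact: cst_continuous.
  by apply: (@continuousM R 'rV[R]_n (fun=> c k) (term p k) w);
    [exact: cst_continuous|exact: continuous_term].
rewrite /determinant; apply: continuous_big => [|s _ w]; first exact: add_continuous.
by apply: (@continuousM R 'rV[R]_n (fun=> _) _ w); [exact: cst_continuous|exact: h].
Qed.

End derivative.

(** * Counting nondegenerate zeros *)
Section rV_norm.
Context {R : realType} {n : nat}.

Lemma rV_norm_le (v : 'rV[R]_n) (r : R) : 0 <= r -> (forall i, `|v 0 i| <= r) -> `|v| <= r.
Proof.
move=> r0 vr; rewrite /Num.norm/= mx_normrE; apply/bigmax_leP; split=> // ij _.
by rewrite (ord1 ij.1).
Qed.

Lemma rV_coord_le (v : 'rV[R]_n) i : `|v 0 i| <= `|v|.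
Proof.
rewrite [leRHS]/Num.norm/= mx_normrE.
exact: (le_bigmax _ (fun ij : 'I_1 * 'I_n => `|v ij.1 ij.2|) (0, i)).
Qed.

Lemma rV_mulmx_bound (A : 'M[R]_n) :
  exists2 C, 0 < C & forall v : 'rV[R]_n, `|v *m A| <= C * `|v|.
Proof.
pose S := \sum_k \sum_i `|A k i|.
have S0 : 0 <= S by apply: sumr_ge0 => k _; apply: sumr_ge0.
exists (S + 1) => [|v]; first by rewrite ltr_wpDl.
apply: rV_norm_le => [|i]; first by rewrite mulr_ge0// addr_ge0.
rewrite mxE; apply: le_trans (ler_norm_sum _ _ _) _.
apply: (@le_trans _ _ (\sum_k `|v| * `|A k i|)).
  by apply: ler_sum => k _; rewrite normrM ler_wpM2r// rV_coord_le.
rewrite -big_distrr/= mulrC ler_wpM2r// ler_wpDr//.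
apply: ler_sum => k _; rewrite (bigD1 i)//= lerDl; exact: sumr_ge0.
Qed.

Lemma separation (Z : seq 'rV[R]_n) : uniq Z ->
  exists2 rho, 0 < rho & forall z z' : 'rV[R]_n, z \in Z -> z' \in Z ->
    forall w, `|w - z| < rho -> `|w - z'| < rho -> z = z'.
Proof.
elim: Z => [_|a Z IH /= /andP[aZ uZ]]; first by exists 1.
have [rho rho0 sepZ] := IH uZ.
have [rho' rho'0 sepa] : exists2 rho', 0 < rho' &
    forall z, z \in Z -> forall w, `|w - z| < rho' -> ~ (`|w - a| < rho').
  elim: Z aZ {IH uZ sepZ} => [_|b Z IH]; first by exists 1.
  rewrite inE negb_or => /andP[ab /IH[r r0 sepr]].
  have ab0 : 0 < `|a - b| by rewrite normr_gt0 subr_eq0.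
  exists (Num.min r (`|a - b| / 2)); first by rewrite lt_min r0 divr_gt0.
  move=> z; rewrite inE => /orP[/eqP->|zZ] w; rewrite !lt_min.
    move=> /andP[_ h1] /andP[_ h2].
    have := ler_normB (w - b) (w - a).
    rewrite (_ : w - b - (w - a) = a - b); last by rewrite opprB addrC addrA subrK.
    by rewrite leNgt => /negP; apply; lra.
  by move=> /andP[h1 _] /andP[h2 _]; exact: (sepr z zZ w).
exists (Num.min rho rho'); first by rewrite lt_min rho0.
move=> z z'; rewrite !inE => /orP[/eqP->|zZ] /orP[/eqP->//|z'Z] w; rewrite !lt_min.
- by move=> /andP[_ h1] /andP[_ h2]; have := sepa z' z'Z w h2 h1.
- by move=> /andP[_ h1] /andP[_ h2]; have := sepa z zZ w h1 h2.
- by move=> /andP[h1 _] /andP[h2 _]; exact: (sepZ z z' zZ z'Z w).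
Qed.

End rV_norm.

Section local_mass.
Context {R : realType} {n : nat} {K : finType}.
Variables (t : K -> 'I_n) (p : K -> 'rV[R]_n) (c : K -> R).
Local Notation F := (system_row t p c).

(** Indicator function of the parallelepiped of the w for which the linear part of
    F at z takes values in the cube of half-side (1 - e) delta; the factor 1 - e
    leaves room for the remainder of order |w - z|. *)
Definition zero_box (e delta : R) (z w : 'rV[R]_n) : R :=
  \prod_i \1_(`[- ((1 - e) * delta), (1 - e) * delta]%classic : set R)
     (((w - z) *m 'J F z) ord0 i).

Lemma zero_box_ge0 e delta z w : 0 <= zero_box e delta z w.
Proof. by apply: prodr_ge0 => i _; rewrite indicE. Qed.

Lemma zero_boxP e delta z w : zero_box e delta z w = 1 /\
    (forall i, `|((w - z) *m 'J F z) 0 i| <= (1 - e) * delta) \/ zero_box e delta z w = 0.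
Proof.
have [h|] := pselect (forall i, `|((w - z) *m 'J F z) 0 i| <= (1 - e) * delta).
  left; split=> //; apply: big1 => i _; rewrite indicE mem_set//=.
  by rewrite in_itv/= -ler_norml.
move=> /existsNP[i hi]; right; apply/eqP; rewrite prodf_seq_eq0; apply/hasP; exists i.
  by rewrite mem_index_enum.
by rewrite indicE memNset//= in_itv/= -ler_norml.
Qed.

Lemma measurable_zero_box e delta z : measurable_fun setT (zero_box e delta z).
Proof.
apply: measurable_prod => i _.
have mm : measurable_fun setT (fun w : 'rV[R]_n => ((w - z) *m 'J F z) ord0 i).
  apply: (measurableT_comp (measurable_coord i)).
  apply: (measurableT_comp (measurable_mulmx _)); exact: measurable_rV_add.
by apply: measurableT_comp mm; exact: measurable_indic.
Qed.

(** The parallelepiped shrinks to z with delta, since the Jacobian matrix is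
    invertible. On it the Taylor remainder is at most e (1 - e) delta, whence
    |F_i| <= (1 + e) (1 - e) delta <= delta, and the determinants, which depend
    continuously on w, are close to their common value at z. *)
Lemma zero_box_small e z (rho : R) (T : {set {ffun 'I_n -> K}}) : 0 < e -> e < 1 ->
  F z = 0 -> \det ('J F z) != 0 -> 0 < rho ->
  exists2 delta0, 0 < delta0 & forall delta, 0 < delta -> delta < delta0 ->
  forall w, (forall i, `|((w - z) *m 'J F z) 0 i| <= (1 - e) * delta) ->
  [/\ `|w - z| < rho, (forall i, `|system t p c w i| <= delta) &
      forall f, f \in T -> (1 - e) * `|\det ('J F z)| <= `|\det (jacmx t p c w f)|].
Proof.
move=> e0 e1 Fz dJ rho0; set J := 'J F z.
have uJ : J \in unitmx by rewrite unitmxE unitfE.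
have [C C0 hC] := rV_mulmx_bound (invmx J).
(* |w - z| <= C (1 - e) delta on the box, so this slope keeps the remainder
   below e (1 - e) delta *)
have e'0 : 0 < e / C by rewrite divr_gt0.
have taylor := taylor_zero Fz e'0.
have detlow (f : {ffun 'I_n -> K}) :
    \forall w \near z, (1 - e) * `|\det J| <= `|\det (jacmx t p c w f)|.
  have cd : `|\det (jacmx t p c w f)| @[w --> z] --> `|\det J|.
    rewrite /J -(jacmx_zero f Fz).
    apply: (@continuous_comp _ _ _ (fun w => \det (jacmx t p c w f)) Num.norm z).
      exact: continuous_det_jacmx.
    exact: norm_continuous.
  have lt1 : (1 - e) * `|\det J| < `|\det J|.
    by rewrite gtr_pMl ?normr_gt0//; lra.
  by apply: (@filterS _ (nbhs z) (nbhs_filter z) _ _ _ (cvgr_gt _ cd _ lt1)) => w; exact: ltW.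
have alllow : \forall w \near z, forall f, f \in T ->
    (1 - e) * `|\det J| <= `|\det (jacmx t p c w f)|.
  have := @filter_forall _ {ffun 'I_n -> K}
    (fun f w => (1 - e) * `|\det J| <= `|\det (jacmx t p c w f)|)
    (nbhs z) (nbhs_filter z) (detlow).
  move=> H; apply: (@filterS _ (nbhs z) (nbhs_filter z) _ _ _ H) => w h f _; exact: h.
have /nbhs_normP[r r0 hr] := @filterI _ (nbhs z) (nbhs_filter z) _ _ taylor alllow.
have rr0 : 0 < Num.min r rho / C by rewrite divr_gt0// lt_min r0.
exists (Num.min r rho / C) => // delta d0 dlt w hw.
have lwz : `|w - z| <= C * ((1 - e) * delta).
  have -> : w - z = ((w - z) *m J) *m invmx J by rewrite mulmxK.
  apply: le_trans (hC _) _; rewrite ler_pM2l//.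
  by apply: rV_norm_le => //; rewrite mulr_ge0 ?(ltW d0)//; lra.
have lt_r : `|w - z| < Num.min r rho.
  apply: le_lt_trans lwz _; move: dlt; rewrite ltr_pdivlMr// => dlt.
  by apply: le_lt_trans dlt; have := mulr_gt0 (mulr_gt0 C0 d0) e0; nra.
move: lt_r; rewrite lt_min => /andP[ltr ltrho].
have [tw dw] : (`|F w - (w - z) *m J| <= e / C * `|w - z|) /\ (forall f, f \in T ->
    (1 - e) * `|\det J| <= `|\det (jacmx t p c w f)|).
  by apply: hr; rewrite /= distrC.
split=> // i.
have -> : system t p c w i = (F w - (w - z) *m J) 0 i + ((w - z) *m J) 0 i.
  by rewrite !mxE subrK.
apply: le_trans (ler_normD _ _) _.
have h1 : `|(F w - (w - z) *m J) 0 i| <= e * ((1 - e) * delta).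
  apply: le_trans (rV_coord_le _ _) _; apply: le_trans tw _.
  by rewrite -mulrA ler_pM2l// mulrC ler_pdivrMr// mulrC.
have := hw i; nra.
Qed.

End local_mass.

Section zero_counting.
Context {R : realType} {n : nat} {K : finType}.
Variables (t : K -> 'I_n) (p : K -> 'rV[R]_n) (c : K -> R).
Variable T : {set {ffun 'I_n -> K}}.
Hypothesis cover : forall w, exists2 f, f \in T & cone t p f w.
Local Notation F := (system_row t p c).
Local Notation zero_box := (zero_box t p c).

Definition kac_count (delta : R) : \bar R :=
  (((2 * delta) ^- n)%:E * \sum_(f in T) \int[lebesgue_rV n]_w (kac_density t p delta f c w)%:E)%E.

(** The determinant cancels against the volume of the parallelepiped. *)
Lemma integral_zero_box e delta z : e < 1 -> 0 < delta -> \det ('J F z) != 0 ->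
  (\int[lebesgue_rV n]_w ((1 - e) * `|\det ('J F z)| * zero_box e delta z w)%:E =
   ((1 - e) ^+ n.+1 * (2 * delta) ^+ n)%:E)%E.
Proof.
move=> e1 d0 dJ.
have uJ : 'J F z \in unitmx by rewrite unitmxE unitfE.
have r0 : 0 <= (1 - e) * delta by rewrite mulr_ge0 ?(ltW d0)//; lra.
have P := parallelepiped_integral z (r := fun=> (1 - e) * delta) uJ (fun=> r0).
under eq_integral do rewrite EFinM.
rewrite ge0_integralZl//; last 3 first.
- by apply/measurable_EFinP; exact: measurable_zero_box.
- by move=> w _; rewrite lee_fin zero_box_ge0.
- by rewrite lee_fin mulr_ge0//; lra.
rewrite EFinM -muleA P -EFinM; congr (_%:E).
by rewrite prodr_const card_ord exprS -mulrA -exprMn mulrCA.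
Qed.

(** For small delta the parallelepipeds around the zeros in Z are disjoint, and on
    each of them the Kac integrand is at least 1 - e times the determinant at the
    zero. *)
Lemma kac_lower_bound (Z : seq 'rV[R]_n) (e : R) : 0 < e -> e < 1 -> uniq Z ->
  (forall z, z \in Z -> F z = 0 /\ \det ('J F z) != 0) ->
  exists2 delta0, 0 < delta0 & forall delta, 0 < delta -> delta < delta0 ->
  (((size Z)%:R * (1 - e) ^+ n.+1)%:E <= kac_count delta)%E.
Proof.
move=> e0 e1 uZ hZ.
have [rho rho0 sep] := separation uZ.
have [delta0 d00 small] : exists2 delta0, 0 < delta0 & forall delta, 0 < delta -> delta < delta0 ->
  forall z, z \in Z -> 
  forall w, (forall i, `|((w - z) *m 'J F z) 0 i| <= (1 - e) * delta) ->
  [/\ `|w - z| < rho, (forall i, `|system t p c w i| <= delta) &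
      forall f, f \in T -> (1 - e) * `|\det ('J F z)| <= `|\det (jacmx t p c w f)|].
  elim: Z hZ {uZ sep} => [_|z Z IH hZ]; first by exists 1.
  have [d1 d10 h1] := IH (fun z' z'Z => hZ z' (mem_behead (s := z :: Z) z'Z)).
  have [Fz dz] := hZ z (mem_head _ _).
  have [d2 d20 h2] := zero_box_small (t := t) (p := p) (c := c) T e0 e1 Fz dz rho0.
  exists (Num.min d1 d2); first by rewrite lt_min d10.
  move=> delta dp; rewrite lt_min => /andP[l1 l2] z'; rewrite inE => /orP[/eqP->|z'Z] w.
    exact: h2.
  exact: h1.
exists delta0 => // delta dp dlt.
have {}small := small delta dp dlt.
have e10 : 0 <= 1 - e by lra.
have c0 : 0 < (2 * delta) ^- n by rewrite invr_gt0 exprn_gt0// mulr_gt0.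
have step : (\int[lebesgue_rV n]_w
  (\sum_(z <- Z) ((1 - e) * `|\det ('J F z)| * zero_box e delta z w)%:E)
    <= \sum_(f in T) \int[lebesgue_rV n]_w (kac_density t p delta f c w)%:E)%E.
  rewrite -big_filter -ge0_integral_sum//; last 2 first.
  - by move=> f; apply/measurable_EFinP;
    exact: (measurable_kac_density t p (c := fun=> c) (w := id)).
  - by move=> f w _; rewrite lee_fin kac_density_ge0.
  have g0 z w : 0 <= (1 - e) * `|\det ('J F z)| * zero_box e delta z w.
    by rewrite !mulr_ge0// zero_box_ge0.
  apply: ge0_le_integral => //.
  - by move=> w _; apply: sume_ge0 => z _; rewrite lee_fin.
  - apply: emeasurable_sum => z; apply/measurable_EFinP; apply: measurable_funM => //.
    exact: measurable_zero_box.
  - apply: emeasurable_sum => f; apply/measurable_EFinP.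
    exact: (measurable_kac_density t p (c := fun=> c) (w := id)).
  move=> w _; rewrite big_filter !sumEFin lee_fin.
  have [/hasP[z zZ nz]|/hasPn nz] := boolP (has (fun z => zero_box e delta z w != 0) Z); last first.
    rewrite big_seq big1 ?sumr_ge0// => [f _|z zZ]; first exact: kac_density_ge0.
    by have := nz z zZ; rewrite negbK => /eqP->; rewrite mulr0.
  have [[nz1 hz]|nz0] := zero_boxP t p c e delta z w; last by rewrite nz0 eqxx in nz.
  have [wz Fw dw] := small z zZ w hz.
  rewrite (bigD1_seq z)//= big_seq_cond big1 ?addr0; last first.
    move=> z' /andP[z'Z z'z];
      have [[_ hz']|->] := zero_boxP t p c e delta z' w;
      last by rewrite mulr0.
    have [wz' _ _] := small z' z'Z w hz'.
    by rewrite (sep z z' zZ z'Z w wz wz') eqxx in z'z.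
  have [f fT wf] := cover w.
  rewrite (bigD1 f)//= ler_wpDr//; first by apply: sumr_ge0 => g _; exact: kac_density_ge0.
  rewrite /kac_density nz1 mulr1 indicE mem_set// mul1r big1 ?mul1r; first exact: dw.
  by move=> i _; rewrite indicE mem_set//= in_itv/= -ler_norml.
rewrite /kac_count; apply: le_trans (lee_wpmul2l _ step); last by rewrite lee_fin ltW.
rewrite ge0_integral_sum//; last 2 first.
- move=> z; apply/measurable_EFinP; apply: measurable_funM => //; exact: measurable_zero_box.
- by move=> z w _; rewrite lee_fin !mulr_ge0// zero_box_ge0.
rewrite (eq_big_seq (fun=> ((1 - e) ^+ n.+1 * (2 * delta) ^+ n)%:E)); last first.
  by move=> z zZ; rewrite integral_zero_box// (hZ z zZ).2.
rewrite sumEFin big_const_seq count_predT iter_addr_0 -EFinM lee_fin.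
rewrite [(1 - e) ^+ _ * _ ^+ n]mulrC -mulrnAr mulrA mulVf ?mul1r ?[_%:R * _]mulr_natl//.
by apply: expf_neq0; rewrite mulrn_eq0/= (gt_eqF dp).
Qed.

(** Finite sets of zeros suffice: an infinite set contains finite subsets of every
    size. For a finite set, e tends to 0 in [kac_lower_bound]. *)
Lemma counting_le_liminf (delta : nat -> R) : (forall m, 0 < delta m) ->
  delta m @[m --> \oo] --> 0 ->
  (counting [set z | F z = 0%R /\ \det ('J F z) != 0%R] <=
   limn_einf (fun m => kac_count (delta m)))%E.
Proof.
move=> dpos dlim.
have fin_case (Z : seq 'rV[R]_n) : uniq Z ->
    (forall z, z \in Z -> F z = 0 /\ \det ('J F z) != 0) ->
    ((size Z)%:R%:E <= limn_einf (fun m => kac_count (delta m)))%E.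
  move=> uZ hZ.
  have below e : 0 < e -> e < 1 -> (((size Z)%:R * (1 - e) ^+ n.+1)%:E <=
      limn_einf (fun m => kac_count (delta m)))%E.
    move=> e0 e1; have [delta0 d00 h] := kac_lower_bound e0 e1 uZ hZ.
    have [N _ hN] : \forall m \near \oo, delta m < delta0.
      exact: (cvgr_lt _ dlim).
    rewrite limn_einf_lim; apply: lime_ge; first exact: is_cvg_einfs.
    near=> M; apply: le_ereal_inf_tmp => _ [m /= Mm <-]; apply: h => //.
    by apply: hN => /=; apply: leq_trans Mm; near: M; exact: nbhs_infty_ge.
  move: below; case: (limn_einf _) => [l|_|below]; last 2 first.
  - exact: leey.
  - have h1 : 0 < 2^-1 :> R by rewrite invr_gt0.
    have h2 : 2^-1 < 1 :> R by rewrite invf_lt1// ltr1n.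
    by have := below _ h1 h2.
  move=> below; rewrite lee_fin leNgt; apply/negP => lZ.
  pose f (e : R) := (size Z)%:R * (1 - e) ^+ n.+1.
  have cf : f e @[e --> (0 : R)^'+] --> ((size Z)%:R : R).
    have -> : ((size Z)%:R : R) = f 0 by rewrite /f subr0 expr1n mulr1.
    apply: cvg_at_right_filter; apply: cvgMr.
    apply: (@continuous_comp _ _ _ (fun e : R => 1 - e) (fun x => x ^+ n.+1)).
      by apply: cvgB; [exact: cvg_cst|exact: cvg_id].
    exact: exprn_continuous.
  near (0 : R)^'+ => e.
  have := below e; rewrite lee_fin -/(f e) leNgt => /(_ _ _)/negP; apply.
  - by near: e; exact: nbhs_right_gt.
  - by near: e; exact: nbhs_right_lt.
  - by near: e; exact: (cvgr_gt _ cf).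
set S := [set z | _]; rewrite /counting; case: asboolP => [finS|infS].
  by apply: fin_case; [exact: fset_uniq|move=> z; rewrite in_fset_set// inE].
rewrite leye_eq; apply/eqP/eqyP => A A0.
have [B BS hB] := infinite_set_fset (Num.truncn A).+1 infS.
apply: (@le_trans _ _ (#|` B|%fset)%:R%:E).
  rewrite lee_fin; apply: ltW; apply: lt_le_trans (truncnS_gt A) _.
  by rewrite ler_nat.
by apply: fin_case; [exact: fset_uniq|move=> z zB; exact: BS].
Unshelve. all: by end_near. Qed.

End zero_counting.

(** * Selections and vertices of the Minkowski sum *)
Lemma dotvC (R : realType) n (u v : 'rV[R]_n) : dotv u v = dotv v u.
Proof. by apply: eq_bigr => j _; rewrite mulrC. Qed.

Lemma dotv_sumr (R : realType) n (I : Type) (s : seq I) (u : 'rV[R]_n) (v : I -> 'rV[R]_n) :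
  dotv u (\sum_(i <- s) v i) = \sum_(i <- s) dotv u (v i).
Proof.
rewrite /dotv exchange_big/=; apply: eq_bigr => j _.
by rewrite summxE big_distrr.
Qed.

(** Split off the largest power of 'X: the cofactor is nonzero at 0, hence near
    0. *)
Lemma poly_near0_nonroot (R : realType) (P : {poly R}) : P != 0 ->
  \forall s \near (0 : R)^'+, P.[s] != 0.
Proof.
move=> P0; have [m [q /implyP/(_ P0) q0 ->]] := multiplicity_XsubC P 0.
have cq : `|q.[s]| @[s --> (0 : R)^'+] --> `|q.[0]|.
  by apply: cvg_norm; apply: cvg_at_right_filter; exact: continuous_horner.
have q00 : 0 < `|q.[0]| by rewrite normr_gt0.
near=> s; have s0 : 0 < s by near: s; exact: nbhs_right_gt.
have qs : 0 < `|q.[s]| by near: s; exact: (cvgr_gt _ cq).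
rewrite hornerM horner_exp !hornerE subr0.
by apply: mulf_neq0; [rewrite -normr_gt0|apply: expf_neq0; rewrite gt_eqF].
Unshelve. all: by end_near. Qed.

Section selections.
Context {R : realType} {n : nat} {K : finType}.
Variables (t : K -> 'I_n) (p : K -> 'rV[R]_n).
Hypothesis t_surj : forall i, exists k, t k == i.
Hypothesis p_inj : forall k k', t k = t k' -> p k = p k' -> k = k'.

Definition strict_max (u : 'rV[R]_n) (f : {ffun 'I_n -> K}) :=
  (forall i, t (f i) = i) /\
  (forall k, k != f (t k) -> dotv (p k) u < dotv (p (f (t k))) u).

Definition strict_selections : {set {ffun 'I_n -> K}} :=
  [set f | `[< exists u, strict_max u f >]]%SET.

Lemma strict_selectionsP f :
  reflect (exists u, strict_max u f) (f \in strict_selections).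
Proof. by rewrite inE; exact: asboolP. Qed.

Definition argmax_selection (u : 'rV[R]_n) : {ffun 'I_n -> K} :=
  [ffun i => [arg max_(k > xchoose (t_surj i) | t k == i) dotv (p k) u]%O].

Lemma argmax_selectionP u : (forall i, t (argmax_selection u i) = i) /\
  (forall k, dotv (p k) u <= dotv (p (argmax_selection u (t k))) u).
Proof.
split=> [i|k]; rewrite ffunE; case: arg_maxP => //=.
- exact: (xchooseP (t_surj i)).
- by move=> j /eqP.
- exact: (xchooseP (t_surj (t k))).
- by move=> j _; apply.
Qed.

(** The direction w is perturbed to u = w + s (1, s, s^2, ...) with a small s > 0.
    For two distinct exponents of the same equation the difference of their
    products with u is a nonzero polynomial in s, so that ties disappear, while
    strict inequalities at w persist; the maximizers at u thus are maximizers
    at w. *)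
Lemma strict_selections_cover w : exists2 f, f \in strict_selections & cone t p f w.
Proof.
pose u (s : R) : 'rV[R]_n := w + s *: \row_j s ^+ j.
pose Q (d : 'rV[R]_n) : {poly R} := (dotv d w)%:P +
  'X * \poly_(j < n) (if insub j is Some i then d 0 i else 0).
have QE d s : dotv d (u s) = (Q d).[s].
  rewrite !hornerE horner_poly /u /dotv.
  under eq_bigr do rewrite !mxE mulrDr.
  rewrite big_split/=; congr (_ + _); rewrite big_distrr/=; apply: eq_bigr => j _.
  by rewrite valK mulrCA mulrA.
have Q0 d : d != 0 -> Q d != 0.
  apply: contraNneq => Qd0; apply/eqP/rowP => j; rewrite mxE.
  have := congr1 (fun P : {poly R} => P`_(j.+1)) Qd0.
  by rewrite coefD coefC coefXM coef_poly ltn_ord valK coef0 add0r.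
have pair_near (kk : K * K) : \forall s \near (0 : R)^'+,
    t kk.1 = t kk.2 -> kk.1 != kk.2 -> dotv (p kk.1 - p kk.2) (u s) != 0 /\
      (0 < dotv (p kk.1 - p kk.2) w -> 0 < dotv (p kk.1 - p kk.2) (u s)).
  have [/andP[/eqP tk kk12]|nkk] := boolP ((t kk.1 == t kk.2) && (kk.1 != kk.2)); last first.
    by apply: nearW => s tk kk12; rewrite tk eqxx kk12 in nkk.
  have d0 : p kk.1 - p kk.2 != 0.
    by rewrite subr_eq0; apply: contraNneq kk12 => /(p_inj tk) ->.
  have nz := poly_near0_nonroot (Q0 _ d0).
  have cQ : (Q (p kk.1 - p kk.2)).[s] @[s --> (0 : R)^'+] --> dotv (p kk.1 - p kk.2) w.
    have -> : dotv (p kk.1 - p kk.2) w = (Q (p kk.1 - p kk.2)).[0].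
      by rewrite -QE /u scale0r addr0.
    by apply: cvg_at_right_filter; exact: continuous_horner.
  have [dw|dw] := ltP 0 (dotv (p kk.1 - p kk.2) w).
    have pos : \forall s \near (0 : R)^'+, 0 < (Q (p kk.1 - p kk.2)).[s].
      exact: (cvgr_gt _ cQ).
    by apply: filterS2 nz pos => s h1 h2 _ _; rewrite QE.
  by apply: filterS nz => s h1 _ _; rewrite QE.
near (0 : R)^'+ => s.
have hs : forall kk : K * K, t kk.1 = t kk.2 -> kk.1 != kk.2 ->
    dotv (p kk.1 - p kk.2) (u s) != 0 /\
      (0 < dotv (p kk.1 - p kk.2) w -> 0 < dotv (p kk.1 - p kk.2) (u s)).
  by near: s; exact: filter_forall.
have [tf fmax] := argmax_selectionP (u s); set f := argmax_selection (u s) in tf fmax *.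
exists f.
  apply/strict_selectionsP; exists (u s); split=> // k kf.
  have tk : t k = t (f (t k)) by rewrite tf.
  have [nz _] := hs (k, f (t k)) tk kf.
  by rewrite lt_neqAle fmax andbT -subr_eq0 -dotvBl.
move=> i k <-; rewrite leNgt; apply/negP => lt_w.
have kf : k != f (t k) by apply/eqP => e; move: lt_w; rewrite -e ltxx.
have tk : t k = t (f (t k)) by rewrite tf.
have [_] := hs (k, f (t k)) tk kf.
by rewrite /= !dotvBl !subr_gt0 => /(_ lt_w); rewrite ltNge fmax.
Unshelve. all: by end_near. Qed.

(** If f is strictly maximal for u, then every other selection has a strictly
    smaller sum of products with u. *)
Lemma strict_selections_inj (f g : {ffun 'I_n -> K}) : f \in strict_selections ->
  g \in strict_selections -> \sum_i p (f i) = \sum_i p (g i) -> f = g.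
Proof.
move=> /strict_selectionsP[u [tf fs]] /strict_selectionsP[_ [tg _]] efg.
have le_gf i : dotv (p (g i)) u <= dotv (p (f i)) u.
  have [->//|gf] := eqVneq (g i) (f i).
  by have := fs (g i); rewrite tg => /(_ gf)/ltW.
have sum0 : \sum_i (dotv (p (f i)) u - dotv (p (g i)) u) = 0.
  rewrite sumrB; apply/eqP; rewrite subr_eq0; apply/eqP.
  under eq_bigr do rewrite dotvC; under [RHS]eq_bigr do rewrite dotvC.
  by rewrite -!dotv_sumr efg.
apply/ffunP => i; apply/eqP; rewrite eq_sym; apply/negPn/negP => gf.
have /eqP := sum0; rewrite psumr_eq0; last by move=> j _; rewrite subr_ge0.
move=> /allP/(_ i (mem_index_enum _)); rewrite /= subr_eq0 => /eqP e.
by have := fs (g i); rewrite tg e ltxx => /(_ gf).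
Qed.

End selections.

Section polytope.
Context {R : realType} {n : nat}.
Implicit Types (S : set 'rV[R]_n) (u x : 'rV[R]_n).
Local Open Scope convex_scope.

Lemma dotv_conv u (x y : convex_lmodType 'rV[R]_n) (l : {i01 R}) :
  dotv u (x <| l |> y) = l%:num * dotv u x + (1 - l%:num) * dotv u y.
Proof.
rewrite /dotv !big_distrr -big_split/=; apply: eq_bigr => j _.
by rewrite !mxE /unstable.onem; ring.
Qed.

Lemma convex_hull_sub S : S `<=` convex_hull S.
Proof. exact: sub_smallest. Qed.

Lemma convex_hull_halfspace S u m : (forall a, S a -> dotv u a <= m) ->
  forall x, convex_hull S x -> dotv u x <= m.
Proof.
move=> Sm x hx; apply: (hx [set x | dotv u x <= m]); split=> // y z l.
rewrite !inE/= => yu zu; rewrite dotv_conv.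
have l0 : 0 <= l%:num by [].
have l1 : l%:num <= 1 by [].
nra.
Qed.

(** The set of all x in the conclusion is convex: a proper convex combination of
    two of its points lies strictly below unless both are a0. *)
Lemma convex_hull_strict_max S u a0 :
  (forall a, S a -> a = a0 \/ dotv u a < dotv u a0) ->
  forall x, convex_hull S x -> x = a0 \/ dotv u x < dotv u a0.
Proof.
move=> Sm x hx; apply: (hx [set x | x = a0 \/ dotv u x < dotv u a0]); split=> //.
apply/convex_setW => y z; rewrite !inE => yu zu l l0 l1; rewrite inE/=. rewrite dotv_conv.
case: yu zu => [->|yu] [->|zu].
- by left; rewrite convmm.
- by right; nra.
- by right; nra.
- by right; nra.
Qed.

End polytope.

Section vertices_of_sum.
Context {R : realType} {n : nat}.
Variable A : 'I_n -> {fset 'rV[R]_n}.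
Hypothesis A_neq0 : forall i, A i != fset0.

(** One index type for the coefficients of all equations, so that their joint
    independence is the independence of a single family. *)
Definition key : finType := {i : 'I_n & A i}.
Definition key_index (k : key) : 'I_n := tag k.
Definition key_point (k : key) : 'rV[R]_n := val (tagged k).

Lemma key_index_surj i : exists k, key_index k == i.
Proof.
have /fset0Pn[a aA] := A_neq0 i.
by exists (Tagged (fun i => A i) [` aA]%fset) => /=.
Qed.

Lemma key_point_inj k k' : key_index k = key_index k' -> key_point k = key_point k' -> k = k'.
Proof.
case: k k' => i a [j b]; rewrite /key_index/= => ij; move: b; rewrite -ij => b.
by rewrite /key_point/= => /val_inj ->.
Qed.

Local Notation M := (minkowski_sum (fun i => convex_hull [set` A i])).
Local Notation T := (strict_selections key_index key_point).

Lemma key_point_in k : convex_hull [set` A (key_index k)] (key_point k).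
Proof. by apply: convex_hull_sub; rewrite /=; exact: valP. Qed.

Lemma selection_sum_in (g : 'I_n -> key) : (forall i, key_index (g i) = i) ->
  M (\sum_i key_point (g i)).
Proof.
move=> tg; exists (fun i => key_point (g i)) => // i.
by have := @key_point_in (g i); rewrite tg.
Qed.

(** A vertex is the only maximizer of some u on the sum, and the sum of the
    maximizers of u in the A i is one of them; hence every vertex is the sum of a
    selection. *)
Lemma finite_vertices : finite_set (vertices M).
Proof.
apply: (@sub_finite_set _ _ [set \sum_i key_point (g i) | g in [set: {ffun 'I_n -> key}]]);
  last by apply: finite_image; exact: finite_finset.
move=> x [u uface].
have [tg gmax] := argmax_selectionP key_point key_index_surj u.
set g := argmax_selection _ _ u in tg gmax.
exists g => //.
have : face M u (\sum_i key_point (g i)); last by rewrite uface.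
split=> [|y [q hq ->]]; first exact: selection_sum_in.
rewrite !dotv_sumr; apply: ler_sum => i _.
apply: (convex_hull_halfspace _ (hq i)) => a /= aA.
have := gmax (Tagged (fun i => A i) [` aA]%fset).
by rewrite /key_point/= dotvC [X in _ <= X -> _]dotvC.
Qed.

(** A functional with a strict maximizer on every A i has a single maximizer on
    each convex hull, hence on the Minkowski sum. *)
Lemma strict_selection_vertex f : f \in T -> vertices M (\sum_i key_point (f i)).
Proof.
move=> /strict_selectionsP[u [tf fs]]; exists u.
have ismax i a : a \in A i -> a = key_point (f i) \/ dotv u a < dotv u (key_point (f i)).
  move=> aA; pose k : key := Tagged (fun i => A i) [` aA]%fset.
  have [<-|kf] := eqVneq k (f i); first by left.
  right; have := fs k kf; rewrite /key_index/= dotvC => /lt_le_trans; apply.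
  by rewrite dotvC.
apply/seteqP; split=> [y [[q hq ->]] ymax|_ ->].
  have hull i := convex_hull_strict_max (fun a aA => ismax i a aA) (hq i).
  rewrite /=; apply: eq_bigr => i _.
  case: (hull i) => // lt_i; exfalso.
  have := ymax _ (selection_sum_in tf); rewrite !dotv_sumr leNgt => /negP; apply.
  rewrite (bigD1 i)//= [ltRHS](bigD1 i)//= ltr_leD//; apply: ler_sum => j _.
  by case: (hull j) => [->//|/ltW].
split; first exact: selection_sum_in.
move=> y [q hq ->]; rewrite !dotv_sumr; apply: ler_sum => i _.
by case: (convex_hull_strict_max (fun a aA => ismax i a aA) (hq i)) => [->//|/ltW].
Qed.

Lemma card_strict_selections : (#|T| <= #|` fset_set (vertices M)|)%N.
Proof.
rewrite cardE -(size_map (fun f : {ffun 'I_n -> key} => \sum_i key_point (f i))).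
apply: uniq_leq_size.
  rewrite map_inj_in_uniq ?enum_uniq// => f g; rewrite !mem_enum.
  exact: strict_selections_inj.
move=> x /mapP[f]; rewrite mem_enum => fT ->.
rewrite in_fset_set; last exact: finite_vertices.
by rewrite inE; exact: strict_selection_vertex.
Qed.

End vertices_of_sum.

(** * The expected number of zeros *)

(** Every simple function below f is below g, whether or not f and g are
    measurable. *)
Lemma ge0_le_lower_integral d (T : measurableType d) (R : realType)
    (mu : {measure set T -> \bar R}) (f g : T -> \bar R) :
  (forall x, 0 <= f x)%E -> (forall x, f x <= g x)%E ->
  (\int[mu]_x f x <= \int[mu]_x g x)%E.
Proof.
move=> f0 fg; rewrite !ge0_integralTE//; last by move=> x; exact: le_trans (fg x).
apply: ge_ereal_sup => _ [h /= hf <-]; apply: ereal_sup_ubound; exists h => // x.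
exact: le_trans (hf x) (fg x).
Qed.

Lemma limn_einf_le (R : realType) (u : (\bar R)^nat) (b : \bar R) :
  (forall m, u m <= b)%E -> (limn_einf u <= b)%E.
Proof.
move=> ub; rewrite limn_einf_lim; apply: lime_le; first exact: is_cvg_einfs.
apply: nearW => m; apply: le_trans (ub m).
by apply: ereal_inf_lbound; exists m => /=.
Qed.

(** Fatou's lemma along delta = 1 / (m + 1), each [kac_count] having at most the
    claimed expectation. *)
Lemma expected_counting_le (R : realType) (n : nat) (K : finType)
    (d : measure_display) (Omega : measurableType d) (P : probability Omega R)
    (t : K -> 'I_n) (p : K -> 'rV[R]_n) (X : K -> {RV P >-> R})
    (T : {set {ffun 'I_n -> K}}) :
  mutually_independent X -> (forall k, standard_gaussian (X k)) ->
  (forall f, f \in T -> forall i, t (f i) = i) ->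
  (forall w, exists2 f, f \in T & cone t p f w) ->
  (\int[P]_om counting [set z | system_row t p (X^~ om) z = 0%R /\
      \det ('J (system_row t p (X^~ om)) z) != 0%R]
   <= (@normal_peak R 1 ^+ n * #|T|%:R *
       \prod_i (#|[pred k | t k == i]|%:R - 1))%:E)%E.
Proof.
move=> indep gauss tT cover.
pose delta (m : nat) : R := m.+1%:R^-1.
have d0 m : 0 < delta m by rewrite invr_gt0.
pose u m om := kac_count t p (X^~ om) T (delta m).
have mI m f : measurable_fun setT
    (fun om => \int[lebesgue_rV n]_w (kac_density t p (delta m) f (X^~ om) w)%:E)%E.
  apply: (measurable_fun_fubini_tonelli_F (m2 := lebesgue_rV n)
    (fun z : Omega * 'rV[R]_n => (kac_density t p (delta m) f (X^~ z.1) z.2)%:E)).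
    by apply/measurable_EFinP; exact: measurable_kac_density_joint.
  by move=> z; rewrite lee_fin kac_density_ge0.
have mS m : measurable_fun setT (fun om =>
    \sum_(f in T) \int[lebesgue_rV n]_w (kac_density t p (delta m) f (X^~ om) w)%:E)%E.
  by under eq_fun do rewrite -big_filter; apply: emeasurable_sum => f.
have mu m : measurable_fun setT (u m).
  by apply: emeasurable_funM; [exact: measurable_cst|exact: mS].
have i0 m f om : (0 <= \int[lebesgue_rV n]_w (kac_density t p (delta m) f (X^~ om) w)%:E)%E.
  by apply: integral_ge0 => w _; rewrite lee_fin kac_density_ge0.
have c0 m : 0 <= (2 * delta m) ^- n by rewrite invr_ge0 exprn_ge0// mulr_ge0// ltW.
have u0 m om : (0 <= u m om)%E.
  by rewrite mule_ge0 ?lee_fin//; apply: sume_ge0 => f _.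
apply: (@le_trans _ _ (\int[P]_om limn_einf (u^~ om))%E).
  apply: ge0_le_lower_integral => om.
    by rewrite /counting; case: asboolP => _; rewrite ?leey ?lee_fin.
  apply: counting_le_liminf => //.
  exact: cvg_harmonic.
apply: le_trans (fatou _ measurableT mu _) _; first by [].
apply: limn_einf_le => m.
rewrite ge0_integralZl ?lee_fin//; last by move=> om _; apply: sume_ge0 => f _.
under eq_integral do rewrite -big_filter.
rewrite ge0_integral_sum//.
rewrite big_filter.
apply: (@le_trans _ _ (((2 * delta m) ^- n)%:E * \sum_(f in T)
  ((2 * delta m * @normal_peak R 1) ^+ n * \prod_i (#|[pred k | t k == i]|%:R - 1))%:E)%E).
  apply: lee_wpmul2l; first by rewrite lee_fin.
  apply: lee_sum => f fT; apply: integral_kac_density => //; first exact: ltW.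
  exact: tT.
rewrite sumEFin -EFinM lee_fin sumr_const [(2 * delta m * _) ^+ n]exprMn.
set D := (2 * delta m) ^+ n; have D0 : D != 0.
  by rewrite /D expf_neq0// mulf_neq0// gt_eqF.
rewrite le_eqVlt; apply/orP; left; apply/eqP.
by rewrite -[_ *+ #|T|]mulr_natr; field.
Qed.

Lemma normal_peak_powR (R : realType) n :
  @normal_peak R 1 ^+ n = (2 * pi) `^ (- (n%:R / 2)).
Proof.
have pi0 := pi_gt0 R.
have pi2 : 0 <= 2 * pi :> R by lra.
by rewrite normal_peak1E powRN [n%:R / 2]mulrC powRrM powR12_sqrt// powR_mulrn ?sqrtr_ge0// exprVn.
Qed.

Section keys.
Context {R : realType} {n : nat} (A : 'I_n -> {fset 'rV[R]_n}).
Local Notation key := (key A).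

Lemma card_key_index i : #|[pred k : key | key_index k == i]| = #|` A i|.
Proof.
rewrite cardfE -!sum1_card.
transitivity (\sum_(j | j == i) \sum_(a : A j) 1)%N; last by rewrite big_pred1_eq.
by rewrite (@sig_big_dep _ _ _ _ (fun j => A j) (pred1 i) (fun _ _ => true) (fun _ _ => 1%N));
  apply: eq_bigl => k; rewrite inE andbT.
Qed.

Lemma expsystem_keys (c : forall i, A i -> R) :
  expsystem c = system_row (@key_index _ _ A) (@key_point _ _ A) (fun k => c (tag k) (tagged k)).
Proof.
apply/funext => w; apply/rowP => i; rewrite !mxE /expsum /system.
transitivity (\sum_(j | j == i) \sum_(a : A j) c j a * expR (dotv (val a) w)).
  by rewrite big_pred1_eq.
rewrite (@sig_big_dep _ _ _ _ (fun j => A j) (pred1 i) (fun _ _ => true)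
  (fun j a => c j a * expR (dotv (val a) w))).
by apply: eq_bigl => k; rewrite andbT.
Qed.

End keys.
Local Open Scope ring_scope.

Unset Implicit Arguments.

Theorem theorem1p1 (R : realType) (n : nat) (n_ge1 : (1 <= n)%N)
    (A : 'I_n -> {fset 'rV[R]_n}) (A_neq0 : forall i, A i != fset0)
    (d : measure_display) (Omega : measurableType d) (P : probability Omega R)
    (c : forall i, A i -> {RV P >-> R})
    (c_gaussian : forall i a, standard_gaussian (c i a))
    (c_independent : mutually_independent
       (fun k : {i : 'I_n & A i} => c (tag k) (tagged k))) :
  let V0 :=
    #|` fset_set (vertices (minkowski_sum (fun i => convex_hull [set` A i])))|
  in
  (expected_nondegenerate_zeros c <=
   ((2 * pi) `^ (- (n%:R / 2)) * V0%:R * \prod_i (#|` A i|%:R - 1))%:E)%E.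
Proof.
cbv zeta.
pose X (k : key A) := c (tag k) (tagged k).
have gauss k : standard_gaussian (X k) by exact: c_gaussian.
have tT f : f \in strict_selections (@key_index _ _ A) (@key_point _ _ A) ->
    forall i, key_index (f i) = i.
  by move=> /strict_selectionsP[u []].
have cover := strict_selections_cover (key_index_surj A_neq0) (@key_point_inj _ _ A).
have cE om : expsystem (fun i a => c i a om) =
    system_row (@key_index _ _ A) (@key_point _ _ A) (X^~ om).
  by rewrite (expsystem_keys (fun i a => c i a om)).
have -> : expected_nondegenerate_zeros c =
    (\int[P]_om counting [set z |
      system_row (@key_index _ _ A) (@key_point _ _ A) (X^~ om) z = 0%R /\
      \det ('J (system_row (@key_index _ _ A) (@key_point _ _ A) (X^~ om)) z) != 0%R])%E.
  rewrite /expected_nondegenerate_zeros.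
  apply: eq_integral => om _.
  rewrite /nondegenerate_zeros.
  rewrite cE.
  by [].
apply: (le_trans (expected_counting_le c_independent gauss tT cover)).
rewrite lee_fin normal_peak_powR; under eq_bigr do rewrite card_key_index.
apply: ler_wpM2r.
  apply: prodr_ge0 => i _; rewrite subr_ge0 ler1n cardfs_gt0; exact: A_neq0.
apply: ler_wpM2l; first exact: powR_ge0.
by rewrite ler_nat; exact: card_strict_selections.
Qed.
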